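(* Let $M\in\mathbb{Q}^{3\times3}$ have eigenvalues $\lambda,\overline{\lambda},\rho$ with $\lambda$ non-real and $\rho$ real, such that $\gamma=\lambda/|\lambda|$ is a root of unity, let $s\in\mathbb{Q}^3$, and let $T=\{x\in\mathbb{R}^3 : p(x)\sim0\}$ with $p\in\mathbb{Z}[x_1,x_2,x_3]$ and ${\sim}\in\{>,\ge\}$. Then there exist an integer $N\le 2^{\|\mathcal{I}_T\|^{c}}$, where $c$ is an absolute constant, and a set $X\subseteq\{0,1,\ldots,287\}$, computable from $M,s,p$, such that for all $n>N$: $M^ns\in T$ if and only if $n\bmod 288\in X$.
   Context: $\|\mathcal{I}_T\|=\|p\|+\|M\|+\|s\|$, where $\|M\|,\|s\|$ are bit lengths of the binary encodings of the rational entries and $\|p\|$ is the bit length of the list of integer coefficients of $p$ (including zeros). *)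

(* Defs.v *)
From mathcomp Require Import all_boot all_order all_algebra.
From mathcomp Require Import complex reals mpoly.

Set Implicit Arguments.
Unset Strict Implicit.
Unset Printing Implicit Defensive.

Import Order.TTheory GRing.Theory Num.Theory.

Local Open Scope ring_scope.

Variant sign_cond := SGt | SGe.

Definition mpeval (R : realType) (p : {mpoly int[3]}) (x : 'cV[R]_3) : R :=
  (map_mpoly intr p).@[fun i => x i 0].

Definition target (R : realType) (p : {mpoly int[3]}) (sim : sign_cond) :
    {pred 'cV[R]_3} :=
  [pred x | match sim with
            | SGt => 0 < mpeval p x
            | SGe => 0 <= mpeval p x
            end].

Arguments target : clear implicits.

Definition is_root_of_unity (F : fieldType) (z : F) : Prop :=
  exists2 k : nat, (0 < k)%N & k.-unity_root z.

(* Dense representation: all monomials of total degree at most deg p, zero     *)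
(* coefficients included; recall that msize p = deg p + 1 for p != 0.          *)
Definition coef_list (p : {mpoly int[3]}) : seq int :=
  let d := msize p in
  [seq p@_[multinom [tuple ijk.1.1; ijk.1.2; ijk.2]] |
     ijk <- [seq (ij, k) |
               ij <- [seq (i, j) | i <- iota 0 d, j <- iota 0 (d - i)],
               k <- iota 0 (d - ij.1 - ij.2)]].

(* One sign bit, then the binary digits of the absolute value ("0" for 0).     *)
Definition int_bits (z : int) : nat := (1 + (trunc_log 2 `|z|).+1)%N.

Definition rat_bits (q : rat) : nat := (int_bits (numq q) + int_bits (denq q))%N.

Definition mx_bits m n (A : 'M[rat]_(m, n)) : nat :=
  (\sum_i \sum_j rat_bits (A i j))%N.

Definition poly_bits (p : {mpoly int[3]}) : nat :=
  (\sum_(z <- coef_list p) int_bits z)%N.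

Definition instance_bits (M : 'M[rat]_3) (s : 'cV[rat]_3) (p : {mpoly int[3]}) :=
  (poly_bits p + mx_bits M + mx_bits s)%N.

(* Kleene's mu-recursive functions. Arities are not tracked: a function reads  *)
(* its arguments from a list, and an absent argument reads as 0.               *)
Inductive recfun :=
  | RZero
  | RSucc
  | RProj of nat
  | RComp of recfun & seq recfun
  | RPrec of recfun & recfun
  | RMu of recfun.

(* [computes f v y]: f is defined at the arguments v, with value y.            *)
(* In [RPrec f g] the recursion is on the first argument, and h lists its      *)
(* successive values: h 0 = f w and h (i+1) = g (i, h i, w).                   *)
Fixpoint computes (f : recfun) (v : seq nat) (y : nat) {struct f} : Prop :=
  match f with
  | RZero => y = 0
  | RSucc => y = (nth 0 v 0).+1
  | RProj i => y = nth 0 v i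
  | RComp f gs =>
      let fix all_compute gs ws {struct gs} : Prop :=
        match gs, ws with
        | [::], [::] => True
        | g :: gs, w :: ws => computes g v w /\ all_compute gs ws
        | _, _ => False
        end in
      exists ws, all_compute gs ws /\ computes f ws y
  | RPrec f g =>
      let n := nth 0 v 0 in
      let w := behead v in
      exists h : nat -> nat,
        [/\ computes f w (h 0),
            forall i, i < n -> computes g [:: i, h i & w] (h i.+1)
          & y = h n]
  | RMu f =>
      computes f (y :: v) 0 /\
      forall i, i < y -> exists k, computes f (i :: v) k.+1
  end%N.

Definition int_code (z : int) : nat :=
  match z with
  | Posz n => n.*2
  | Negz n => n.*2.+1
  end.

Definition mx_codes m n (A : 'M[rat]_(m, n)) : seq nat :=
  flatten [seq [:: int_code (numq (A ij.1 ij.2)); int_code (denq (A ij.1 ij.2))]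
          | ij <- [seq (i, j) | i <- enum 'I_m, j <- enum 'I_n]].

(* A tuple of 18 + 6 + 1 + 1 natural numbers; the last one is the code of the  *)
(* whole list of coefficients.                                                 *)
Definition instance_codes (M : 'M[rat]_3) (s : 'cV[rat]_3)
    (p : {mpoly int[3]}) : seq nat :=
  mx_codes M ++ mx_codes s ++
  [:: msize p; CodeSeq.code [seq int_code z | z <- coef_list p]].

Definition set_code n (X : {set 'I_n}) : nat := (\sum_(i in X) 2 ^ i)%N.

(* Main.v *)
Require Import Defs.
From mathcomp Require Import all_boot all_order all_algebra.
From mathcomp Require Import complex reals mpoly.
From mathcomp Require Import ring zify.

(** Scaling by a common denominator, one may assume that M is an integer matrix.
    If rho is rational, then w = lam / conj lam is a root of unity whose trace
    w + 1/w is a rational algebraic integer in [-2, 2], so w^12 = 1; otherwise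
    reducing lam^k = (conj lam)^k modulo the characteristic polynomial shows that
    this polynomial is X^3 - t. In both cases M^288 has at most two distinct
    eigenvalues a, b, both natural numbers, and it is diagonalizable. Hence along
    each residue class modulo 288 the homogenized value of p on the orbit is a sum
    of terms c h^m with c an integer and h a natural number. The largest base with
    nonzero total coefficient dominates as soon as m exceeds (max h) * (sum |c|),
    by Bernoulli's inequality, and this threshold is singly exponential in the
    size of the instance. The residue set is computed by evaluating the sign once
    in each class, at an index beyond the threshold. *)

Set Implicit Arguments.
Unset Strict Implicit.
Unset Printing Implicit Defensive.

Import Order.TTheory GRing.Theory Num.Theory.

Local Open Scope ring_scope.

(** * Eigenvalues *)

(** That the bases are natural numbers is what keeps the threshold elementary: distinct bases differ
    by at least 1, so no lower bound for differences of powers of algebraic numbers is called for.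
    Hence the even exponent 24 = 2 * 12: the eigenvalues of the power must be nonnegative integers,
    not merely rational. The period is 288 = 24 * 12. A Jordan block would add factors polynomial in
    m; it is excluded because lam, conj lam and rho are distinct, so a polynomial vanishing at all
    three annihilates the matrix.

    Two devices keep every quantity in Z. Homogenizing [p] turns the denominators of the orbit into
    one more geometric term, and the spectral formula for powers is multiplied by the difference of
    the two eigenvalues, a factor that homogeneity removes again.

    The two thresholds have different duties. [N] must be singly exponential in the bit length,
    while the algorithm may sample at any computable index beyond the sign threshold; it uses one
    built from the codes that it reads, so that no logarithm has to be computed. *)

Lemma coprimez_dvd_exp (p q : int) k :
  coprimez p q -> (q %| p ^+ k)%Z -> `|q|%N = 1%N.
Proof.
move=> cpq; rewrite -(mulr1 (p ^+ k)) Gauss_dvdzr ?dvdz1; first by move/eqP.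
by rewrite coprimez_sym coprimezXl.
Qed.

Lemma Qint_num_dvd_exp (x : rat) k :
  (denq x %| numq x ^+ k)%Z -> x = (numq x)%:~R.
Proof.
move=> /coprimez_dvd_exp den1; rewrite -[LHS]divq_num_den.
have -> : denq x = 1 by rewrite -absz_denq den1 // coprimezE coprime_num_den.
by rewrite divr1.
Qed.

(* With x = p / q in lowest terms, d_n := q^n (w^n + w^-n) is an integer
   congruent to p^n modulo q, whereas d_k = 2 q^k. *)
Lemma root_unity_trace_int (F : numFieldType) (w : F) (x : rat) k :
  (0 < k)%N -> w ^+ k = 1 -> w + w^-1 = ratr x -> x = (numq x)%:~R.
Proof.
case: k => // k _ wk1 wx.
have w0 : w != 0 by apply: contra_eq_neq wk1 => ->; rewrite expr0n eq_sym oner_neq0.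
set p := numq x; set q := denq x.
have q0 : (q%:~R : F) != 0 by rewrite intr_eq0 denq_neq0.
have px : (p%:~R : F) = (w + w^-1) * q%:~R.
  by rewrite wx /ratr -/p -/q mulfVK.
have [d [e [dE eE ep]]] : exists d e : int,
  [/\ d%:~R = q%:~R ^+ k * (w ^+ k + w ^- k),
      e%:~R = q%:~R ^+ k.+1 * (w ^+ k.+1 + w ^- k.+1)
    & (q %| e - p ^+ k.+1)%Z].
  elim: {wk1}k => [|k [d [e [dE eE ep]]]].
    exists 2, p; split; last by rewrite expr1 subrr dvdz0.
      by rewrite !expr0 invr1 mul1r.
    by rewrite px !expr1 mulrC.
  (* Since p = q (w + 1/w), the sequence obeys d_(n+2) = p d_(n+1) - q^2 d_n; the induction carries
     two consecutive terms. *)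
  exists e, (p * e - q ^+ 2 * d); split; first exact: eE.
    rewrite rmorphB !rmorphM /= px dE eE -!exprVn !exprS.
    by field.
  have -> : p * e - q ^+ 2 * d - p ^+ k.+2 = p * (e - p ^+ k.+1) - q * (q * d).
    by rewrite (exprS p k.+1); ring.
  by apply: rpredB; [apply: dvdz_mull | apply: dvdz_mulr].
apply: (@Qint_num_dvd_exp _ k.+1); rewrite -/p -/q.
have <- : e - (e - p ^+ k.+1) = p ^+ k.+1 by rewrite subKr.
apply: rpredB => //; suff -> : e = q ^+ k.+1 * 2 by rewrite exprS -mulrA dvdz_mulr.
apply: (@intr_inj F); rewrite eE wk1 invr1 rmorphM rmorphXn /=.
by congr (_ * _).
Qed.

(** Rational root theorem: multiplying the monic equation by q^3, for r = p / q in lowest terms,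
    shows that q divides p^3. *)
Lemma cubic_root_int (r : rat) (t1 t2 t3 : int) :
  r ^+ 3 = t1%:~R * r ^+ 2 - t2%:~R * r + t3%:~R -> r = (numq r)%:~R.
Proof.
move=> rE; apply: (@Qint_num_dvd_exp _ 3).
set p := numq r; set q := denq r.
have q0 : (q%:~R : rat) != 0 by rewrite intr_eq0 denq_neq0.
have pE : p%:~R = r * q%:~R :> rat by rewrite -[r in RHS]divq_num_den mulfVK.
suff -> : p ^+ 3 = q * (t1 * p ^+ 2 - t2 * p * q + t3 * q ^+ 2) by rewrite dvdz_mulr.
apply: (@intr_inj rat).
rewrite !(rmorphD, rmorphB, rmorphM, rmorphXn, rmorphN) /= pE.
transitivity (r ^+ 3 * q%:~R ^+ 3); first by ring.
by rewrite rE; ring.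
Qed.

(** Here w is a root of X^2 - x X + 1 with |x| <= 2. For x = -2, -1, 0, 1, 2 its order is 2, 3, 4,
    6, 1, and 12 is the least common multiple of these orders. *)
Lemma root_unity_small_trace (F : numFieldType) (w : F) (x : int) :
  `|w| = 1 -> w + w^-1 = x%:~R -> w ^+ 12 = 1.
Proof.
move=> w1 wx.
have w0 : w != 0 by rewrite -normr_eq0 w1 oner_neq0.
have w2 : w ^+ 2 = x%:~R * w - 1.
  by rewrite -wx; field.
have : `|x| <= 2.
  rewrite -(ler_int F) intr_norm -wx (le_trans (ler_normD _ _)) //.
  by rewrite normfV w1 invr1.
have w4 : w ^+ 12 = (w ^+ 2) ^+ 6 by rewrite -exprM.
move=> x2.
have: x = -2 \/ x = -1 \/ x = 0 \/ x = 1 \/ x = 2 by lia.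
move=> [xE|[xE|[xE|[xE|xE]]]]; rewrite xE in w2.
- have -> : w = -1.
    apply/eqP; rewrite -subr_eq0 opprK -sqrf_eq0 sqrrD1 w2; apply/eqP.
    rewrite -mulr_natr; ring.
  by rewrite -signr_odd.
- have w3 : w ^+ 3 = 1.
    transitivity ((w - 1) * (w ^+ 2 + w + 1) + 1); first by ring.
    by rewrite w2; ring.
  by rewrite (_ : 12 = 3 * 4)%N // exprM w3 expr1n.
- by rewrite w4 w2 mul0r sub0r -signr_odd.
- have w3 : w ^+ 3 = -1.
    transitivity ((w + 1) * (w ^+ 2 - w + 1) - 1); first by ring.
    by rewrite w2; ring.
  by rewrite (_ : 12 = 3 * 4)%N // exprM w3 -signr_odd.
- have -> : w = 1.
    apply/eqP; rewrite -subr_eq0 -sqrf_eq0 sqrrB1 w2; apply/eqP.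
    rewrite -mulr_natr; ring.
  by rewrite expr1n.
Qed.

(** The order of quantifiers matters: one integer triple, the remainder of X^k modulo the cubic,
    serves all roots at once. *)
Lemma cubic_power_reduction (F : comPzRingType) (t1 t2 t3 : int) k :
  exists a b c : int, forall z : F,
    z ^+ 3 = t1%:~R * z ^+ 2 - t2%:~R * z + t3%:~R ->
    z ^+ k = a%:~R + b%:~R * z + c%:~R * z ^+ 2.
Proof.
elim: k => [|k [a [b [c abcE]]]].
  by exists 1, 0, 0 => z _; rewrite expr0 !mul0r !addr0.
exists (c * t3), (a - c * t2), (b + c * t1) => z z3.
rewrite exprS (abcE z z3) !(rmorphD, rmorphB, rmorphM, rmorphN) /=.
transitivity (a%:~R * z + b%:~R * z ^+ 2 + c%:~R * z ^+ 3); first by ring.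
by rewrite z3; ring.
Qed.

(* Reducing X^k modulo the cubic, lam^k = (lam^* )^k forces either a rational
   value of lam + lam^* or a constant remainder; in the latter case all three
   roots have the same modulus. *)
Lemma cubic_root_dichotomy (C : numClosedFieldType) (lam rho : C)
    (t1 t2 t3 : int) k :
  lam \isn't Num.real -> rho \is Num.real ->
  t1%:~R = lam + lam^* + rho ->
  t2%:~R = lam * lam^* + (lam + lam^* ) * rho ->
  t3%:~R = lam * lam^* * rho ->
  (0 < k)%N -> lam ^+ k = lam^* ^+ k ->
  (exists r : rat, rho = ratr r) \/
  [/\ lam ^+ 3 = t3%:~R, lam^* ^+ 3 = t3%:~R & rho ^+ 3 = t3%:~R].
Proof.
move=> lamNR rhoR t1E t2E t3E k0 lamk.
have lamJ : lam - lam^* != 0.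
  by rewrite subr_eq0 eq_sym -CrealE.
have lam0 : lam != 0 by apply: contraNneq lamNR => ->; rewrite rpred0.
pose f (z : C) := z ^+ 3 = t1%:~R * z ^+ 2 - t2%:~R * z + t3%:~R.
have flam : f lam by rewrite /f t1E t2E t3E; ring.
have flamJ : f lam^* by rewrite /f t1E t2E t3E; ring.
have frho : f rho by rewrite /f t1E t2E t3E; ring.
have [a [b [c abcE]]] := cubic_power_reduction C t1 t2 t3 k.
have lamE := abcE _ flam; have lamJE := abcE _ flamJ; have rhoE := abcE _ frho.
have : (lam - lam^* ) * (c%:~R * (lam + lam^* ) + b%:~R) = 0.
  transitivity (lam ^+ k - lam^* ^+ k); last by rewrite lamk subrr.
  by rewrite lamE lamJE; ring.
move/eqP; rewrite mulf_eq0 (negPf lamJ) /= => /eqP cb.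
(* A nonzero [c] gives lam + lam^* = - b / c, so that rho = t1 + b / c is rational. *)
have [c0|c0] := eqVneq c 0; last first.
  left; exists (t1%:~R + b%:~R / c%:~R).
  have c0' : c%:~R != 0 :> C by rewrite intr_eq0.
  rewrite rmorphD fmorph_div /= !ratr_int t1E.
  have -> : (b%:~R : C) = - (c%:~R * (lam + lam^* )).
    by apply/eqP; rewrite -addr_eq0 addrC cb.
  by field.
have b0 : b%:~R = 0 :> C by move: cb; rewrite c0 mul0r add0r.
have lamrho : `|lam| = `|rho|.
  apply: (@pexpIrn _ k); rewrite ?nnegrE ?normr_ge0 // -!normrX lamE rhoE.
  by rewrite b0 c0 !mul0r.
have rho2 : lam * lam^* = rho ^+ 2.
  by rewrite -normCK lamrho real_normK.
have rho0 : rho != 0 by rewrite -normr_eq0 -lamrho normr_eq0.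
(* Equal moduli force t2 = t1 rho. Either t1 is nonzero and rho = t2 / t1, or t1 = t2 = 0 and the
   cubic is X^3 - t3. *)
have t12 : t1%:~R * rho = t2%:~R by rewrite t1E t2E rho2; ring.
have rho3 : rho ^+ 3 = t3%:~R by rewrite t3E rho2; ring.
have [t10|t10] := eqVneq t1 0; last first.
  left; exists (t2%:~R / t1%:~R).
  have t10' : t1%:~R != 0 :> C by rewrite intr_eq0.
  by rewrite fmorph_div /= !ratr_int -t12; field.
have t20 : t2%:~R = 0 :> C by rewrite -t12 t10 mul0r.
by right; split=> //; rewrite ?flam ?flamJ t20 t10 !mul0r subrr add0r.
Qed.

(** If rho is rational, lam^12 equals the 12th power of its conjugate, so lam^24 = v^12 for the
    integer v = |lam|^2. Otherwise all three cubes equal t3 and the 24th powers are t3^8. Only even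
    powers of integers occur, whence natural numbers. *)
Lemma cubic_root_power24 (C : numClosedFieldType) (lam rho : C)
    (t1 t2 t3 : int) k :
  lam \isn't Num.real -> rho \is Num.real ->
  t1%:~R = lam + lam^* + rho ->
  t2%:~R = lam * lam^* + (lam + lam^* ) * rho ->
  t3%:~R = lam * lam^* * rho ->
  (0 < k)%N -> lam ^+ k = lam^* ^+ k ->
  exists a b : nat,
    [/\ lam ^+ 24 = a%:R, lam^* ^+ 24 = a%:R & rho ^+ 24 = b%:R].
Proof.
move=> lamNR rhoR t1E t2E t3E k0 lamk.
have absE (z : int) n : ((z%:~R ^+ n.*2 : C) = (`|z| ^ n.*2)%N%:R).
  rewrite natrX natr_absz intr_norm -!mul2n !exprM real_normK //.
  exact: realz.
have [[r rE]|[lam3 lamJ3 rho3]] :=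
    cubic_root_dichotomy lamNR rhoR t1E t2E t3E k0 lamk; last first.
  exists (`|t3| ^ 8)%N, (`|t3| ^ 8)%N.
  by rewrite -(absE _ 4%N) (_ : 24 = 3 * 8)%N // !exprM lam3 lamJ3 rho3.
have lam0 : lam != 0 by apply: contraNneq lamNR => ->; rewrite rpred0.
have lamJ0 : lam^* != 0 by rewrite conjC_eq0.
have rZ : r = (numq r)%:~R.
  apply: (@cubic_root_int r t1 t2 t3); apply: (@fmorph_inj _ C ratr).
  rewrite !(rmorphD, rmorphB, rmorphM, rmorphXn, rmorphN) /= -rE !ratr_int.
  by rewrite t1E t2E t3E; ring.
have rhoE : rho = (numq r)%:~R by rewrite rE {1}rZ ratr_int.
pose u := t1 - numq r; pose v := t2 - u * numq r.
have uE : lam + lam^* = u%:~R by rewrite /u rmorphB /= t1E -rhoE; ring.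
have vE : lam * lam^* = v%:~R.
  by rewrite /v rmorphB rmorphM /= -uE t2E -rhoE; ring.
pose w := lam / lam^*.
have w1 : `|w| = 1 by rewrite normf_div norm_conjC divff ?normr_eq0.
have wk : w ^+ k = 1 by rewrite /w exprMn exprVn lamk divff ?expf_neq0.
(* The trace of w is the sum of the squares of lam and lam^*, divided by their product. *)
have wx : w + w^-1 = ratr ((u ^+ 2 - 2 * v)%:~R / v%:~R).
  rewrite fmorph_div /= !ratr_int rmorphB rmorphXn rmorphM /= -uE -vE /w.
  by field; apply/andP.
have xZ := root_unity_trace_int k0 wk wx.
rewrite xZ ratr_int in wx.
have w12 := root_unity_small_trace w1 wx.
have lam12 : lam ^+ 12 = lam^* ^+ 12.
  have lamw : lam = w * lam^* by rewrite mulfVK.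
  by rewrite {1}lamw exprMn w12 mul1r.
exists (`|v| ^ 12)%N, (`|numq r| ^ 24)%N.
rewrite -(absE _ 6%N) -(absE _ 12%N) -vE -rhoE exprMn.
by split; rewrite // -[24%N]/(12 + 12)%N exprD ?lam12 // {1}lam12.
Qed.

(** The entrywise l1 norm: a submultiplicative natural number that bounds every entry and, for
    square matrices, every eigenvalue. *)
Definition mx_norm1 m n (A : 'M[int]_(m, n)) : nat :=
  (\sum_i \sum_j `|A i j|)%N.

Lemma leq_absz_add (x y : int) : (`|(x + y)%R| <= `|x| + `|y|)%N.
Proof. by lia. Qed.

Lemma leq_absz_sum (I : Type) (r : seq I) (P : pred I) (F : I -> int) :
  (`|(\sum_(i <- r | P i) F i)%R| <= \sum_(i <- r | P i) `|F i|)%N.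
Proof.
elim/big_rec2: _ => // i x y _ le_yx.
by apply: leq_trans (leq_absz_add _ _) _; rewrite leq_add2l.
Qed.

Lemma leq_entry_mx_norm1 m n (A : 'M[int]_(m, n)) i j :
  (`|A i j| <= mx_norm1 A)%N.
Proof.
by rewrite /mx_norm1 (bigD1 i) //= (bigD1 j) //= -addnA leq_addr.
Qed.

Lemma mx_norm1_mul m n p (A : 'M[int]_(m, n)) (B : 'M[int]_(n, p)) :
  (mx_norm1 (A *m B) <= mx_norm1 A * mx_norm1 B)%N.
Proof.
rewrite /mx_norm1 big_distrl /=; apply: leq_sum => i _.
apply: (@leq_trans (\sum_j \sum_k `|A i k| * `|B k j|)%N).
  apply: leq_sum => j _; rewrite mxE; apply: leq_trans (leq_absz_sum _ _ _) _.
  by apply: leq_sum => k _; rewrite abszM.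
rewrite exchange_big big_distrl /=; apply: leq_sum => k _.
by rewrite -big_distrr leq_mul2l [X in _ || (_ <= X)%N](bigD1 k) //= leq_addr orbT.
Qed.

Lemma mx_norm1_expM n (A : 'M[int]_n) p (B : 'M[int]_(n, p)) k :
  (mx_norm1 (A ^+ k *m B) <= mx_norm1 A ^ k * mx_norm1 B)%N.
Proof.
elim: k => [|k IHk]; first by rewrite expr0 mul1mx mul1n.
rewrite exprS expnS -mulmxE -mulmxA -mulnA.
by apply: leq_trans (mx_norm1_mul _ _) _; rewrite leq_mul2l IHk orbT.
Qed.

(** For a row eigenvector v, sum |z| |v_j| <= sum_i |v_i| |A_ij| over j and divide by the l1 norm of
    v; each row sum of |A| is at most the norm. *)
Lemma root_char_poly_norm1 (C : numFieldType) n (A : 'M[int]_n) (z : C) :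
  root (char_poly (map_mx intr A)) z -> `|z| <= (mx_norm1 A)%:R.
Proof.
rewrite -eigenvalue_root_char => /eigenvalueP[v vA v0].
pose s := \sum_j `|v 0 j|.
have s_gt0 : 0 < s.
  rewrite lt_def sumr_ge0 ?andbT => [|j _]; last exact: normr_ge0.
  apply: contra_neq v0 => s0; apply/rowP => j; rewrite mxE.
  have /psumr_eq0P/(_ s0)/(_ j isT)/eqP : forall j, true -> 0 <= `|v 0 j| by [].
  by rewrite normr_eq0 => /eqP.
rewrite -(ler_pM2r s_gt0) /s mulr_sumr.
apply: (@le_trans _ _ (\sum_j \sum_i `|v 0 i| * `|A i j|%N%:R)).
  apply: ler_sum => j _.
  have -> : `|z| * `|v 0 j| = `|\sum_i v 0 i * (A i j)%:~R|.
    rewrite -normrM; congr `|_|; move/rowP/(_ j): vA; rewrite !mxE => <-.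
    by apply: eq_bigr => i _; rewrite mxE.
  apply: le_trans (ler_norm_sum _ _ _) _; apply: ler_sum => i _.
  by rewrite normrM natr_absz intr_norm.
rewrite exchange_big /= /s mulr_sumr; apply: ler_sum => i _.
rewrite -mulr_sumr mulrC ler_wpM2r ?normr_ge0 // -natr_sum ler_nat.
by rewrite /mx_norm1 [leqRHS](bigD1 i) //= leq_addr.
Qed.

Lemma map_mx_expr (R S : pzRingType) (f : {rmorphism R -> S}) n
    (A : 'M[R]_n) k : map_mx f (A ^+ k) = map_mx f A ^+ k.
Proof.
elim: k => [|k IHk]; first by rewrite !expr0 map_mx1.
by rewrite !exprS -mulmxE map_mxM IHk.
Qed.

Lemma prod3_XsubC (F : comNzRingType) (a b c : F) :
  ('X - a%:P) * ('X - b%:P) * ('X - c%:P) =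
  'X^3 - (a + b + c)%:P * 'X^2 + (a * b + (a + b) * c)%:P * 'X - (a * b * c)%:P.
Proof. by rewrite !(rmorphD, rmorphM) /=; ring. Qed.

(** The three roots are distinct, so a polynomial vanishing at all of them is a multiple of the
    characteristic polynomial and annihilates the matrix by Cayley-Hamilton. This applies to (X^K -
    a)(X^K - b), and to X^K - a alone when a = b. *)
Lemma matrix_power_two_eigenvalues (C : numClosedFieldType) (A : 'M[int]_3)
    (lam rho : C) k j :
  char_poly (map_mx intr A) =
    ('X - lam%:P) * ('X - (lam^* )%:P) * ('X - rho%:P) ->
  lam \isn't Num.real -> rho \is Num.real ->
  (0 < k)%N -> lam ^+ k = lam^* ^+ k ->
  exists a b : nat,
    [/\ (a <= mx_norm1 A ^ (24 * j))%N, (b <= mx_norm1 A ^ (24 * j))%N,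
        (A ^+ (24 * j) - a%:Z%:M) *m (A ^+ (24 * j) - b%:Z%:M) = 0
      & a = b -> A ^+ (24 * j) = a%:Z%:M].
Proof.
move=> chA lamNR rhoR k0 lamk.
have coefA i : ((char_poly A)`_i)%:~R =
    (('X - lam%:P) * ('X - (lam^* )%:P) * ('X - rho%:P))`_i.
  by rewrite -chA -map_char_poly coef_map.
rewrite prod3_XsubC in coefA.
have [a [b [lamE lamJE rhoE]]] : exists a b : nat,
    [/\ lam ^+ 24 = a%:R, lam^* ^+ 24 = a%:R & rho ^+ 24 = b%:R].
  (* Vieta: the elementary symmetric functions of the eigenvalues are, up to sign, the integer
     coefficients of [char_poly A]. *)
  apply: (@cubic_root_power24 _ _ _ (- (char_poly A)`_2) (char_poly A)`_1
            (- (char_poly A)`_0) k) => //;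
  by rewrite ?rmorphN /= coefA !(coefD, coefN, coefCM, coefXn, coefX, coefC) /=; ring.
exists (a ^ j)%N, (b ^ j)%N.
have lamNJ : lam != lam^* by rewrite eq_sym -CrealE.
have rho_lam : rho != lam by apply: contraNneq lamNR => <-.
have rho_lamJ : rho != lam^*.
  by apply: contraNneq lamNR => rE; rewrite -(conjCK lam) -rE conj_Creal.
have rootA z : z \in [:: lam; lam^*; rho] -> root (char_poly (map_mx intr A)) z.
  rewrite chA !inE !rootM !root_XsubC.
  by case/or3P => ->; rewrite ?orbT.
have natbound z c : z \in [:: lam; lam^*; rho] -> z ^+ 24 = c%:R ->
    (c ^ j <= mx_norm1 A ^ (24 * j))%N.
  move=> /rootA/root_char_poly_norm1 zA zc; rewrite expnM.
  suff cA : (c <= mx_norm1 A ^ 24)%N by case: (j) => // j'; rewrite leq_exp2r.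
  rewrite -(ler_nat C) natrX -[c%:R]normr_nat -zc normrX.
  by rewrite lerXn2r ?nnegrE ?normr_ge0 ?ler0n.
have zj z c : z ^+ 24 = c%:R -> z ^+ (24 * j) = (c ^ j)%N%:R :> C.
  by move=> zc; rewrite exprM zc natrX.
move: (24 * j)%N natbound zj => K natbound zj.
have annihil (p : {poly C}) : all (root p) [:: lam; lam^*; rho] ->
    horner_mx (map_mx intr A) p = 0.
  move=> rootp.
  have /(uniq_roots_prod_XsubC rootp)[q ->] : uniq_roots [:: lam; lam^*; rho].
    by rewrite uniq_rootsE /= !inE negb_or lamNJ eq_sym rho_lam eq_sym rho_lamJ.
  rewrite !big_cons big_nil mulr1 (mulrA ('X - lam%:P)) -chA rmorphM /= Cayley_Hamilton.
  by rewrite mulr0.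
have hornerE c : horner_mx (map_mx intr A) ('X^K - (c%:R : C)%:P) =
    map_mx intr (A ^+ K - c%:Z%:M).
  rewrite rmorphB rmorphXn /= horner_mx_X horner_mx_C map_mxB map_scalar_mx.
  by rewrite map_mx_expr.
have rootXn z c : z ^+ 24 = c%:R -> root ('X^K - ((c ^ j)%N%:R : C)%:P) z.
  by move=> zc; rewrite /root hornerD hornerN hornerXn hornerC (zj _ _ zc) subrr.
have intr_mx_inj : injective (map_mx (intr : int -> C) : 'M_3 -> 'M_3).
  move=> X Y /matrixP XY; apply/matrixP => i1 i2.
  by apply: (@intr_inj C); move: (XY i1 i2); rewrite !mxE.
split.
- by apply: natbound lamE; rewrite inE eqxx.
- by apply: natbound rhoE; rewrite !inE eqxx !orbT.
- apply: intr_mx_inj; rewrite map_mxM -!hornerE mulmxE -rmorphM /= annihil.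
    by rewrite map_mx0.
  by rewrite /= !rootM (rootXn _ _ lamE) (rootXn _ _ lamJE) (rootXn _ _ rhoE) orbT.
- move=> ab; apply/eqP; rewrite -subr_eq0; apply/eqP; apply: intr_mx_inj.
  rewrite -hornerE annihil ?map_mx0 //= (rootXn _ _ lamE) (rootXn _ _ lamJE).
  by rewrite ab (rootXn _ _ rhoE).
Qed.

(** * Characteristic polynomial of a scaled matrix *)

Lemma comp_char_poly_scale (F : comNzRingType) n (c : F) (A : 'M[F]_n) :
  char_poly (c *: A) \Po (c *: 'X) = c ^+ n *: char_poly A.
Proof.
rewrite /char_poly -det_map_mx -[RHS]mul_polyC rmorphXn /= -detZ; congr (\det _).
apply/matrixP => i j; rewrite !mxE rmorphB rmorphMn /= comp_polyX comp_polyC.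
by rewrite mulrBr mulrnAr -mul_polyC rmorphM.
Qed.

(** Substituting c X for X is invertible, so the two sides may be compared after it, where the
    scaled determinant is c^3 times the original one. *)
Lemma char_poly_scale3 (F : fieldType) (c : F) (A : 'M[F]_3) (x y z : F) :
  c != 0 -> char_poly A = ('X - x%:P) * ('X - y%:P) * ('X - z%:P) ->
  char_poly (c *: A) =
    ('X - (c * x)%:P) * ('X - (c * y)%:P) * ('X - (c * z)%:P).
Proof.
move=> c0 chA.
have cancel_comp (p : {poly F}) : (p \Po (c *: 'X)) \Po (c^-1 *: 'X) = p.
  by rewrite -comp_polyA comp_polyZ comp_polyX scalerA divff // scale1r comp_polyXr.
rewrite -[LHS]cancel_comp comp_char_poly_scale chA -[RHS]cancel_comp.
congr (_ \Po _); rewrite !comp_polyM !comp_polyB !comp_polyX !comp_polyC.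
by rewrite -!mul_polyC rmorphXn !polyCM /=; ring.
Qed.

(** * Exponential sums *)

(** [H] bounds the bases and [S] the total absolute coefficient. Bases may repeat, so sums are
    concatenations and products are lists of pairwise products; equal bases are collected only when
    the sign is read off. *)
Definition expsum (H S : nat) (G : nat -> int) : Prop :=
  exists l : seq (int * nat),
    [/\ all (fun t => t.2 <= H)%N l, (\sum_(t <- l) `|t.1| <= S)%N
      & forall m, G m = \sum_(t <- l) t.1 * t.2%:Z ^+ m].

Lemma expsum_ext H S G G' : G =1 G' -> expsum H S G -> expsum H S G'.
Proof. by move=> GG' [l [lH lS GE]]; exists l; split=> // m; rewrite -GG' GE. Qed.

Lemma expsum_geometric (c : int) (h : nat) :
  expsum h `|c| (fun m => c * h%:Z ^+ m).
Proof.
exists [:: (c, h)]; split=> /= [||m]; rewrite ?big_seq1 //.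
by rewrite leqnn.
Qed.

Lemma expsum_const (c : int) : expsum 1 `|c| (fun=> c).
Proof.
by apply: expsum_ext (expsum_geometric c 1) => m; rewrite expr1n mulr1.
Qed.

Lemma expsum_weaken H S H' S' G :
  (H <= H')%N -> (S <= S')%N -> expsum H S G -> expsum H' S' G.
Proof.
move=> HH' SS' [l [lH lS GE]]; exists l; split=> //; last exact: leq_trans lS _.
by apply: sub_all lH => t /leq_trans; apply.
Qed.

Lemma expsumD H S S' G G' : expsum H S G -> expsum H S' G' ->
  expsum H (S + S') (fun m => G m + G' m).
Proof.
move=> [l [lH lS GE]] [l' [lH' lS' GE']]; exists (l ++ l'); split.
- by rewrite all_cat lH.
- by rewrite big_cat leq_add.
- by move=> m; rewrite big_cat GE GE'.
Qed.

Lemma expsum_sum (I : eqType) (r : seq I) H (S : I -> nat) (G : I -> nat -> int) :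
  (forall i, i \in r -> expsum H (S i) (G i)) ->
  expsum H (\sum_(i <- r) S i) (fun m => \sum_(i <- r) G i m).
Proof.
elim: r => [|i r IHr] GS; first by exists [::]; split=> [||m]; rewrite ?big_nil.
have GSr j : j \in r -> expsum H (S j) (G j).
  by move=> jr; apply: GS; rewrite inE jr orbT.
rewrite big_cons; apply: expsum_ext (expsumD (GS i (mem_head _ _)) (IHr GSr)) => m.
by rewrite big_cons.
Qed.

Lemma expsumM H S H' S' G G' : expsum H S G -> expsum H' S' G' ->
  expsum (H * H') (S * S') (fun m => G m * G' m).
Proof.
move=> [l [lH lS GE]] [l' [lH' lS' GE']].
exists [seq (t.1 * t'.1, (t.2 * t'.2)%N) | t <- l, t' <- l']; split.
- apply/allP => _ /allpairsP[[t t'] [tl tl' ->]] /=.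
  by rewrite leq_mul ?(allP lH) ?(allP lH').
- rewrite big_allpairs_dep /=; apply: leq_trans (leq_mul lS lS').
  rewrite big_distrl /=; apply: leq_sum => t _; rewrite big_distrr /=.
  by apply: leq_sum => t' _; rewrite abszM.
- move=> m; rewrite GE GE' big_allpairs_dep /= mulr_suml; apply: eq_bigr => t _.
  rewrite mulr_sumr; apply: eq_bigr => t' _.
  by rewrite PoszM exprMn mulrACA.
Qed.

Lemma expsumX H S G k : expsum H S G ->
  expsum (H ^ k) (S ^ k) (fun m => G m ^+ k).
Proof.
move=> GS; elim: k => [|k IHk]; first exact: (expsum_const 1).
by rewrite !expnS; apply: expsum_ext (expsumM GS IHk) => m; rewrite exprS.
Qed.

(** Bernoulli's inequality for (1 + 1/y)^(m+1) with denominators cleared, which admits y = 0. *)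
Lemma bernoulli_nat y m : (y ^ m.+1 + m.+1 * y ^ m <= y.+1 ^ m.+1)%N.
Proof.
elim: m => [|m IHm]; first by rewrite !expn0 !expn1 muln1 addn1.
rewrite (expnS y.+1); apply: leq_trans (leq_mul (leqnn y.+1) IHm).
by rewrite !(expnS y); move: (y ^ m)%N => z; nia.
Qed.

(** The linear Bernoulli term m y^(m-1) already exceeds S y^m once m > S y; the remaining y^m gives
    strictness. *)
Lemma exp_dominates S y m : (S * y < m)%N -> (S * y ^ m < y.+1 ^ m)%N.
Proof.
case: m => // m; case: y => [|y] ySm; first by rewrite exp0n // muln0 exp1n.
apply: leq_trans (bernoulli_nat y.+1 m).
rewrite expnS mulnA -addn1 addnC leq_add ?muln_gt0 ?expn_gt0 //.
by rewrite leq_mul2r ltnW ?orbT.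
Qed.

Lemma sgr_dominated (x y : int) : (`|x| < `|y|)%N -> Num.sg (x + y) = Num.sg y.
Proof.
case: (ltrgt0P y) => [y0|y0|->] xy.
- by rewrite !gtr0_sg //; lia.
- by rewrite !ltr0_sg //; lia.
- by rewrite absz0 ltn0 in xy.
Qed.

Lemma expsum_nat_sign (c : nat -> int) n S :
  (\sum_(h < n) `|c h| <= S)%N ->
  exists e : int, forall m, (n.-1 * S < m)%N ->
    Num.sg (\sum_(h < n) c h * h%:Z ^+ m) = e.
Proof.
elim: n S => [|n IHn] S.
  by move=> _; exists 0 => m _; rewrite big_ord0 sgr0.
rewrite big_ord_recr /= => cS.
have [c0|c0] := eqVneq (c n) 0.
  have [e eE] : exists e : int, forall m, (n.-1 * S < m)%N ->
      Num.sg (\sum_(h < n) c h * h%:Z ^+ m) = e.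
    by apply: IHn; apply: leq_trans cS; rewrite leq_addr.
  exists e => m nSm; rewrite big_ord_recr /= c0 mul0r addr0 eE //.
  by apply: leq_ltn_trans nSm; rewrite leq_mul2r leq_pred orbT.
case: n IHn cS c0 => [|n] _ cS c0.
  (* The only base is 0. The sum vanishes because m > 0; at m = 0 it would be [c 0], as 0^0 = 1. *)
  exists 0 => m; rewrite mul0n; case: m => // m _.
  by rewrite big_ord_recr big_ord0 /= exprS mul0r mulr0 addr0 sgr0.
exists (Num.sg (c n.+1)) => m nSm; rewrite big_ord_recr /= sgr_dominated.
  by rewrite sgrM [X in _ * X]gtr0_sg ?mulr1 // exprn_gt0.
rewrite abszM abszX /=.
apply: (@leq_ltn_trans (S * n ^ m)%N).
  apply: leq_trans (leq_absz_sum _ _ _) _.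
  apply: (@leq_trans (\sum_(h < n.+1) `|c h| * n ^ m)%N).
    apply: leq_sum => h _; rewrite abszM abszX /= leq_mul2l; apply/orP; right.
    by case: (m) => // m'; rewrite leq_exp2r // -ltnS.
  rewrite -big_distrl /= leq_mul2r; apply/orP; right; apply: leq_trans cS.
  by rewrite leq_addr.
apply: (@leq_trans (n.+1 ^ m)); last by rewrite leq_pmull // lt0n absz_eq0.
by apply: exp_dominates; apply: leq_ltn_trans nSm; rewrite mulnC leq_mul2r leqnSn orbT.
Qed.

(** Grouping terms by base leaves one coefficient for each h <= H, and the triangle inequality keeps
    their absolute sum at most [S]. *)
Lemma expsum_sign H S G : expsum H S G ->
  exists e : int, forall m, (H * S < m)%N -> Num.sg (G m) = e.
Proof.
move=> [l [lH lS GE]].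
pose c h := \sum_(t <- l | t.2 == h) t.1.
have cE (T : nmodType) (F : int * nat -> T) :
    \sum_(t <- l) F t = \sum_(h < H.+1) \sum_(t <- l | t.2 == h) F t.
  rewrite (exchange_big_dep xpredT) //= big_seq [RHS]big_seq.
  apply: eq_bigr => t /(allP lH); rewrite -ltnS => tH.
  by rewrite (big_pred1 (Ordinal tH)) // => h; rewrite /= eq_sym.
have [|e eE] := @expsum_nat_sign c H.+1 S.
  apply: leq_trans lS; rewrite [leqRHS](cE nat).
  by apply: leq_sum => h _; apply: leq_absz_sum.
exists e => m /eE <-; congr Num.sg; rewrite GE cE; apply: eq_bigr => h _.
by rewrite mulr_suml; apply: eq_bigr => t /eqP ->.
Qed.

(** * Homogenized evaluation *)

(** The exponent list underlying [coef_list], in the same order. *)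
Definition triples (d : nat) : seq (nat * nat * nat) :=
  [seq (ij, k) | ij <- [seq (i, j) | i <- iota 0 d, j <- iota 0 (d - i)],
                 k <- iota 0 (d - ij.1 - ij.2)].

Definition mnm3 (x : nat * nat * nat) : 'X_{1..3} :=
  [multinom [tuple x.1.1; x.1.2; x.2]].

Lemma mem_triples d x : (x \in triples d) = (x.1.1 + x.1.2 + x.2 < d)%N.
Proof.
case: x => [[i j] k] /=; apply/allpairsPdep/idP => /=.
  move=> [[i' j']] [k'] [/allpairsPdep[i1 [j1 []]]].
  rewrite !mem_iota /= => ? ? [-> ->] ? [-> -> ->]; lia.
move=> ijk; exists (i, j), k; split=> //; last by rewrite mem_iota /=; lia.
by apply/allpairsPdep; exists i, j; rewrite !mem_iota; split=> //=; lia.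
Qed.

Lemma uniq_triples d : uniq (triples d).
Proof.
apply: allpairs_uniq_dep => [|ij _|[ij k] [ij' k'] _ _ /= [-> ->]] //.
- apply: allpairs_uniq_dep => [|i _|[i j] [i' j'] _ _ /= [-> ->]] //;
  exact: iota_uniq.
- exact: iota_uniq.
Qed.

Definition ord3_0 : 'I_3 := Ordinal (isT : 0 < 3)%N.
Definition ord3_1 : 'I_3 := Ordinal (isT : 1 < 3)%N.
Definition ord3_2 : 'I_3 := Ordinal (isT : 2 < 3)%N.

Lemma big_ord3 (T : Type) (idx : T) (op : Monoid.law idx) (F : 'I_3 -> T) :
  \big[op/idx]_i F i = op (F ord3_0) (op (F ord3_1) (F ord3_2)).
Proof.
rewrite !big_ord_recl big_ord0 Monoid.mulm1.
by congr (op (F _) (op (F _) (F _))); apply: val_inj.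
Qed.

Lemma mnm3E x : ((mnm3 x ord3_0 = x.1.1) * (mnm3 x ord3_1 = x.1.2)
  * (mnm3 x ord3_2 = x.2))%type.
Proof. by []. Qed.

(** The degree bound puts the support inside the dense list, and the other triples contribute
    zero. *)
Lemma sum_msupp_triples (V : nmodType) (R : ringType) (p : {mpoly R[3]})
    (F : 'X_{1..3} -> V) :
  (forall m, m \notin msupp p -> F m = 0) ->
  \sum_(m <- msupp p) F m = \sum_(x <- triples (msize p)) F (mnm3 x).
Proof.
move=> F0.
have mnm3_inj : injective mnm3.
  move=> [[i j] k] [[i' j'] k'] /mnmP E.
  by move: (E ord3_0) (E ord3_1) (E ord3_2); rewrite !mnm3E /= => -> -> ->.
rewrite -(big_map mnm3 xpredT F) [RHS](bigID (mem (msupp p))) /=.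
rewrite [X in _ = _ + X]big1 ?addr0 => [|m /F0] //.
rewrite -[RHS]big_filter; apply: perm_big; apply: uniq_perm => [||m].
- exact: msupp_uniq.
- by rewrite filter_uniq // map_inj_uniq ?uniq_triples.
rewrite mem_filter; case: (boolP (m \in msupp p)) => //= mp; apply/esym.
have mE : m = mnm3 (m ord3_0, m ord3_1, m ord3_2).
  apply/mnmP => i; case: i => [[|[|[|i]]] lti] //=; rewrite -[RHS]/(m _);
  by congr (m _); apply: val_inj.
rewrite mE map_f // mem_triples /=; apply: leq_trans (msize_mdeg_lt mp).
by rewrite mdegE big_ord3 /= addnA.
Qed.

(** Homogenization in degree [msize p]: for q nonzero this is q^(msize p) p(u / q), an integer with
    the sign of p(u / q) when q > 0. *)
Definition hom_eval (p : {mpoly int[3]}) (u : 'cV[int]_3) (q : int) : int :=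
  \sum_(x <- triples (msize p))
    p@_(mnm3 x) * (u ord3_0 0 ^+ x.1.1 * u ord3_1 0 ^+ x.1.2 * u ord3_2 0 ^+ x.2
                   * q ^+ (msize p - x.1.1 - x.1.2 - x.2)).

Lemma hom_evalE (R : realType) (p : {mpoly int[3]}) (u : 'cV[int]_3) (q : int) :
  q != 0 ->
  (hom_eval p u q)%:~R =
    q%:~R ^+ msize p * mpeval p ((q%:~R : R)^-1 *: map_mx intr u).
Proof.
move=> q0; have q0' : (q%:~R : R) != 0 by rewrite intr_eq0.
rewrite /mpeval mevalE (perm_big _ (msupp_map_mpoly _ (@intr_inj R))) /=.
under eq_bigr do rewrite mcoeff_map_mpoly /=.
rewrite sum_msupp_triples => [|m mp]; last by rewrite memN_msupp_eq0 ?mul0r.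
rewrite rmorph_sum mulr_sumr big_seq [RHS]big_seq; apply: eq_bigr => x.
rewrite mem_triples => xd; rewrite big_ord3 !mnm3E !mxE.
rewrite !(rmorphM, rmorphXn) /= [RHS]mulrCA; congr (_ * _).
have : msize p = (x.1.1 + x.1.2 + x.2 + (msize p - x.1.1 - x.1.2 - x.2))%N by lia.
set e := (msize p - _ - _ - _)%N => dE.
rewrite dE !exprD !exprMn !exprVn.
have /(_ x.1.1) := expf_neq0 _ q0'; have /(_ x.1.2) := expf_neq0 _ q0'.
have /(_ x.2) := expf_neq0 _ q0'.
move: (q%:~R ^+ _) (q%:~R ^+ _) (q%:~R ^+ _) => a b c a0 b0 c0.
field; exact/and3P.
Qed.

(** Homogeneity: a positive factor common to [u] and [q] does not affect the sign, so denominators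
    of the spectral formula can be cleared. *)
Lemma hom_eval_scale p (u : 'cV[int]_3) (q c : int) :
  hom_eval p (c *: u) (c * q) = c ^+ msize p * hom_eval p u q.
Proof.
rewrite /hom_eval mulr_sumr big_seq [RHS]big_seq; apply: eq_bigr => x.
rewrite mem_triples => xd; rewrite !mxE !exprMn [RHS]mulrCA; congr (_ * _).
have : msize p = (x.1.1 + x.1.2 + x.2 + (msize p - x.1.1 - x.1.2 - x.2))%N by lia.
set e := (msize p - _ - _ - _)%N => dE.
rewrite dE !exprD; move: (c ^+ _) (c ^+ _) (c ^+ _) (c ^+ _) => c1 c2 c3 c4.
by move: (u _ _ ^+ _) (u _ _ ^+ _) (u _ _ ^+ _) (q ^+ _) => *; ring.
Qed.

(** Every monomial has exactly [msize p] factors taken from [u] and [q], so all monomials obey the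
    same bounds. *)
Lemma expsum_hom_eval (p : {mpoly int[3]}) H S (u : nat -> 'cV[int]_3)
    (q : nat -> int) :
  (forall i, expsum H S (fun m => u m i 0)) -> expsum H S q ->
  expsum (H ^ msize p) (\sum_(z <- coef_list p) `|z| * S ^ msize p)%N
    (fun m => hom_eval p (u m) (q m)).
Proof.
move=> uS qS; rewrite /hom_eval.
rewrite big_map -/(triples _); apply: expsum_sum => x.
rewrite mem_triples -/(mnm3 x) => xd.
have : msize p = (x.1.1 + x.1.2 + x.2 + (msize p - x.1.1 - x.1.2 - x.2))%N by lia.
set e := (msize p - _ - _ - _)%N => dE.
rewrite -[(H ^ _)%N]mul1n dE !expnD.
apply: expsumM; first exact: expsum_const.
by apply: expsumM; [apply: expsumM; [apply: expsumM|]|]; apply: expsumX.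
Qed.

(** Spectral decomposition without division: [B] acts as [a] on the image of B - b and as [b] on the
    image of B - a. *)
Lemma mx_pow_two_eigenvalues n (B : 'M[int]_n) (a b : int) m :
  (B - a%:M) *m (B - b%:M) = 0 ->
  (a - b) *: B ^+ m = a ^+ m *: (B - b%:M) - b ^+ m *: (B - a%:M).
Proof.
move=> Bab.
have Bba : (B - b%:M) *m (B - a%:M) = 0.
  rewrite -Bab !mulmxBl !mulmxBr !mul_scalar_mx !mul_mx_scalar.
  rewrite !scale_scalar_mx (mulrC a b) !opprB addrACA [RHS]addrACA.
  by congr (_ + _); rewrite addrC.
have stepE c d : (B - c%:M) *m (B - d%:M) = 0 -> B *m (B - d%:M) = c *: (B - d%:M).
  by rewrite mulmxBl mul_scalar_mx => /eqP; rewrite subr_eq0 => /eqP.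
elim: m => [|m IHm].
  by rewrite !expr0 !scale1r opprB [RHS]addrC addrA subrK scalemx1 raddfB.
rewrite !exprS -mulmxE scalemxAr IHm mulmxBr -!scalemxAr (stepE _ _ Bab).
by rewrite (stepE _ _ Bba) !scalerA ![_ ^+ m * _]mulrC.
Qed.

(** The factor [k] is |a - b|, which clears the spectral formula, or 1 when a = b. It is positive
    and the same for all coordinates and all m, as needed to cancel it by homogeneity. *)
Lemma expsum_orbit (A : 'M[int]_3) (v : 'cV[int]_3) (a b K Y r : nat) :
  (3 < Y)%N -> (mx_norm1 A <= Y)%N -> (mx_norm1 v <= Y)%N -> (r < K)%N ->
  (a <= Y ^ K)%N -> (b <= Y ^ K)%N ->
  (A ^+ K - a%:Z%:M) *m (A ^+ K - b%:Z%:M) = 0 ->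
  (a = b -> A ^+ K = a%:Z%:M) ->
  exists2 k : nat, (0 < k <= Y ^ K)%N & forall i,
    expsum (Y ^ K) (Y ^ (2 * K + 1)) (fun m => k%:Z * (A ^+ (K * m + r) *m v) i 0).
Proof.
move=> Y4 AY vY rK aY bY Aab Aeq.
have Y0 : (0 < Y)%N by lia.
pose w := A ^+ r *m v.
have powE m : A ^+ (K * m + r) *m v = (A ^+ K) ^+ m *m w.
  by rewrite exprD exprM -mulmxE mulmxA.
have normE k i : (`|(A ^+ k *m v) i 0%R| <= Y ^ (k + 1))%N.
  apply: leq_trans (leq_entry_mx_norm1 _ _ _) _.
  apply: leq_trans (mx_norm1_expM _ _ _) _; rewrite addn1 expnSr.
  by apply: leq_mul => //; case: k => // k; rewrite leq_exp2r.
have [ab|nab] := eqVneq a b.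
  exists 1%N; first by rewrite expn_gt0 Y0.
  move=> i; apply: (@expsum_ext _ _ (fun m => w i 0 * a%:Z ^+ m)).
    move=> m; rewrite mul1r powE (Aeq ab) -scalemx1 exprZn expr1n.
    by rewrite -scalemxAl mul1mx [in RHS]mxE mulrC.
  apply: expsum_weaken (expsum_geometric _ _) => //.
  by apply: leq_trans (normE r i) _; rewrite leq_pexp2l //; lia.
exists `|a%:Z - b%:Z|%N.
  rewrite absz_gt0 subr_eq0 eqz_nat nab /=.
  by apply: (@leq_trans (maxn a b)); [lia | rewrite geq_max aY].
move=> i; set U := (A ^+ K - b%:Z%:M) *m w; set W := (A ^+ K - a%:Z%:M) *m w.
(* The sign of a - b moves into the coefficients, leaving |a - b| as multiplier. *)
pose s := Num.sg (a%:Z - b%:Z).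
apply: (@expsum_ext _ _ (fun m => s * U i 0 * a%:Z ^+ m + - (s * W i 0) * b%:Z ^+ m)).
  move=> m; rewrite abszE [`|_|]normrEsg -/s powE.
  have -> : s * (a%:Z - b%:Z) * ((A ^+ K) ^+ m *m w) i 0 =
      s * (((a%:Z - b%:Z) *: (A ^+ K) ^+ m) *m w) i 0.
    by rewrite -scalemxAl [in RHS]mxE mulrA.
  rewrite (mx_pow_two_eigenvalues _ Aab) mulmxBl -!scalemxAl -/U -/W.
  have -> (x y : 'cV[int]_3) c d : (c *: x - d *: y) i 0 = c * x i 0 - d * y i 0.
    by rewrite !mxE.
  by move: (U i 0) (W i 0) (a%:Z ^+ m) (b%:Z ^+ m) => *; ring.
have sU (x : 'cV[int]_3) : (`|(s * x i 0)%R| <= `|x i 0%R|)%N.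
  by rewrite abszM -[leqRHS]mul1n leq_mul2r /s; case: sgrP; rewrite ?orbT.
have UW c : (c <= Y ^ K)%N ->
    (`|((A ^+ K - c%:Z%:M) *m w) i 0%R| <= 2 * Y ^ (2 * K))%N.
  move=> cY; rewrite mulmxBl mul_scalar_mx mxE mul2n -addnn.
  apply: leq_trans (leq_absz_add _ _) _; apply: leq_add.
    rewrite mulmxA mulmxE -exprD; apply: leq_trans (normE _ _) _.
    by rewrite leq_pexp2l //; lia.
  rewrite mxE abszN mxE abszM /= mul2n -addnn expnD leq_mul //.
  by apply: leq_trans (normE _ _) _; rewrite leq_pexp2l //; lia.
(* Two coefficients of size at most 2 Y^(2K) add up to 4 Y^(2K) <= Y^(2K+1); this is where Y > 3
   enters. *)
apply: (@expsum_weaken (Y ^ K) (2 * Y ^ (2 * K) + 2 * Y ^ (2 * K))) => //.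
  by rewrite -mulnDl expnD expn1 mulnC leq_mul2l Y4 orbT.
apply: expsumD; apply: expsum_weaken (expsum_geometric _ _) => //.
  exact: leq_trans (sU _) (UW _ bY).
by rewrite abszN; apply: leq_trans (sU _) (UW _ aY).
Qed.

(** The denominator of the orbit is a single geometric term of base D^K, so after multiplication by
    [k] it shares the bounds of the numerators. *)
Lemma hom_eval_orbit_sign (A : 'M[int]_3) (v : 'cV[int]_3) p
    (a b K Y r D E : nat) :
  (3 < Y)%N -> (mx_norm1 A <= Y)%N -> (mx_norm1 v <= Y)%N -> (r < K)%N ->
  (D <= Y)%N -> (E <= Y)%N -> (a <= Y ^ K)%N -> (b <= Y ^ K)%N ->
  (A ^+ K - a%:Z%:M) *m (A ^+ K - b%:Z%:M) = 0 ->
  (a = b -> A ^+ K = a%:Z%:M) ->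
  exists e : int, forall m,
    ((Y ^ K) ^ msize p *
       (\sum_(z <- coef_list p) `|z| * (Y ^ (2 * K + 1)) ^ msize p) < m)%N ->
    Num.sg (hom_eval p (A ^+ (K * m + r) *m v) (D ^ (K * m + r) * E)%N%:Z) = e.
Proof.
move=> Y4 AY vY rK DY EY aY bY Aab Aeq.
have [k /andP[k0 kY] kS] := expsum_orbit Y4 AY vY rK aY bY Aab Aeq.
have Y0 : (0 < Y)%N by lia.
pose u m := k%:Z *: (A ^+ (K * m + r) *m v).
pose q m : int := k%:Z * (D ^ (K * m + r) * E)%N%:Z.
have powY n : (D ^ n <= Y ^ n)%N by case: n => // n; rewrite leq_exp2r.
have uS i : expsum (Y ^ K) (Y ^ (2 * K + 1)) (fun m => u m i 0).
  by apply: expsum_ext (kS i) => m; rewrite [RHS]mxE.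
have qS : expsum (Y ^ K) (Y ^ (2 * K + 1)) q.
  apply: (@expsum_ext _ _ (fun m => (k * (D ^ r * E))%N%:Z * (D ^ K)%N%:Z ^+ m)).
    by move=> m; rewrite /q expnD expnM -!natz -natrX -!natrM; congr _%:R; ring.
  apply: expsum_weaken (expsum_geometric _ _) => //=.
  rewrite (_ : 2 * K + 1 = K + (K + 1))%N; last by lia.
  rewrite expnD leq_mul //; apply: (@leq_trans (Y ^ r * Y)); first by rewrite leq_mul.
  by rewrite -expnSr leq_pexp2l //; lia.
have [e eE] := expsum_sign (expsum_hom_eval p uS qS).
exists e => m /eE <-; rewrite /u /q hom_eval_scale sgrM.
have -> : Num.sg (k%:Z ^+ msize p) = 1 by apply/gtr0_sg/exprn_gt0.
by rewrite mul1r.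
Qed.

(** * Bit lengths *)

(** A common denominator that need not be least: as a product it is at most 2 to the sum of the bit
    lengths. *)
Definition mx_den m n (M : 'M[rat]_(m, n)) : nat :=
  (\prod_ij `|denq (M ij.1 ij.2)|)%N.

Definition mx_num m n (M : 'M[rat]_(m, n)) : 'M[int]_(m, n) :=
  \matrix_(i, j) (numq (M i j) *
    (\prod_(kl | kl != (i, j)) `|denq (M kl.1 kl.2)|)%N%:Z).

Lemma mx_den_gt0 m n (M : 'M[rat]_(m, n)) : (0 < mx_den M)%N.
Proof. by rewrite prodn_gt0 // => ij; rewrite absz_gt0 denq_neq0. Qed.

Lemma mx_numE (F : numFieldType) m n (M : 'M[rat]_(m, n)) :
  map_mx intr (mx_num M) = (mx_den M)%:R *: map_mx ratr M :> 'M[F]_(m, n).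
Proof.
apply/matrixP => i j; rewrite !mxE /mx_den [X in X%:R](bigD1 (i, j)) //=.
rewrite intrM natrM -pmulrn mulrAC; congr (_ * _).
by rewrite natr_absz normr_denq mulrC /ratr mulfVK // intr_eq0 denq_neq0.
Qed.

Lemma absz_lt_bits (z : int) : (`|z| < 2 ^ int_bits z)%N.
Proof.
apply: leq_trans (trunc_log_ltn _ (isT : 1 < 2)%N) _.
by rewrite /int_bits leq_exp2l // leq_addl.
Qed.

Lemma mx_bitsE m n (M : 'M[rat]_(m, n)) :
  mx_bits M = (\sum_ij rat_bits (M ij.1 ij.2))%N.
Proof. by rewrite /mx_bits pair_big. Qed.

Lemma mx_den_bits m n (M : 'M[rat]_(m, n)) : (mx_den M <= 2 ^ mx_bits M)%N.
Proof.
rewrite mx_bitsE expn_sum; apply: leq_prod => ij _.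
apply: leq_trans (ltnW (absz_lt_bits _)) _.
by rewrite leq_exp2l // leq_addl.
Qed.

Lemma mx_num_entry_bits m n (M : 'M[rat]_(m, n)) i j :
  (`|mx_num M i j| <= 2 ^ mx_bits M)%N.
Proof.
rewrite mxE abszM mx_bitsE expn_sum [leqRHS](bigD1 (i, j)) //=; apply: leq_mul.
  apply: leq_trans (ltnW (absz_lt_bits _)) _.
  by rewrite leq_exp2l // leq_addr.
apply: leq_prod => ij _; apply: leq_trans (ltnW (absz_lt_bits _)) _.
by rewrite leq_exp2l // leq_addl.
Qed.

Lemma mx_num_norm1_bits m n (M : 'M[rat]_(m, n)) :
  (mx_norm1 (mx_num M) <= m * n * 2 ^ mx_bits M)%N.
Proof.
apply: (@leq_trans (\sum_(i < m) \sum_(j < n) 2 ^ mx_bits M)%N).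
  by do 2!(apply: leq_sum => ? _); apply: mx_num_entry_bits.
by rewrite !sum_nat_const !card_ord mulnA.
Qed.

Lemma int_bits_ge2 z : (1 < int_bits z)%N.
Proof. by []. Qed.

Lemma mx_bits_ge m n (M : 'M[rat]_(m, n)) : (m * n * 4 <= mx_bits M)%N.
Proof.
apply: (@leq_trans (\sum_(i < m) \sum_(j < n) 4)%N).
  by rewrite !sum_nat_const !card_ord mulnA.
by do 2!(apply: leq_sum => ? _); apply: (@leq_add 2 2); apply: int_bits_ge2.
Qed.

(** Strictness carries the induction: x < A and y < B give x + y < A B for positive integers A and
    B. *)
Lemma sum_absz_bits (l : seq int) :
  (\sum_(z <- l) `|z| < 2 ^ \sum_(z <- l) int_bits z)%N.
Proof.
elim: l => [|z l IHl]; first by rewrite !big_nil.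
rewrite !big_cons expnD; move: (absz_lt_bits z) IHl; nia.
Qed.

(** This rests on listing zero coefficients: the dense list has an entry for every pure power x_1^i
    with i < [msize p], so the degree is bounded by the bit length. *)
Lemma msize_poly_bits p : (msize p <= poly_bits p)%N.
Proof.
apply: (@leq_trans (size (coef_list p))); last first.
  rewrite -sum1_size /poly_bits; apply: leq_sum => z _; exact: ltnW.
rewrite size_map -/(triples _) -[leqLHS](size_iota 0).
rewrite -(size_map (fun i => (i, 0, 0)%N)); apply: uniq_leq_size.
  by rewrite map_inj_uniq ?iota_uniq // => i j [].
move=> _ /mapP [i + ->]; rewrite mem_iota add0n => id.
by rewrite mem_triples /= !addn0.
Qed.

Definition orbit_num (M : 'M[rat]_3) (s : 'cV[rat]_3) n : 'cV[int]_3 :=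
  mx_num M ^+ n *m mx_num s.

Definition orbit_den (M : 'M[rat]_3) (s : 'cV[rat]_3) n : nat :=
  (mx_den M ^ n * mx_den s)%N.

Lemma orbit_den_gt0 M s n : (0 < orbit_den M s n)%N.
Proof. by rewrite muln_gt0 expn_gt0 !mx_den_gt0. Qed.

Lemma orbitE (F : numFieldType) (M : 'M[rat]_3) (s : 'cV[rat]_3) n :
  map_mx ratr (M ^+ n *m s) =
    (orbit_den M s n)%:R^-1 *: map_mx intr (orbit_num M s n) :> 'cV[F]_3.
Proof.
rewrite map_mxM map_mx_expr [map_mx intr _]map_mxM map_mx_expr !mx_numE exprZn.
rewrite -scalemxAl -scalemxAr !scalerA natrM natrX -mulrA mulVf ?scale1r //.
by rewrite mulf_neq0 ?expf_neq0 // pnatr_eq0 -lt0n mx_den_gt0.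
Qed.

Definition sign_holds (sim : sign_cond) (z : int) : bool :=
  match sim with SGt => 0 < z | SGe => 0 <= z end.

Lemma sign_holds_sg sim z : sign_holds sim (Num.sg z) = sign_holds sim z.
Proof. by case: sim; rewrite /= ?sgr_gt0 ?sgr_ge0. Qed.

Lemma target_orbit (R : realType) (M : 'M[rat]_3) (s : 'cV[rat]_3) p sim n :
  (map_mx ratr (M ^+ n *m s) \in target R p sim) =
  sign_holds sim (hom_eval p (orbit_num M s n) (orbit_den M s n)).
Proof.
have q0 : ((orbit_den M s n)%:Z != 0) by rewrite eqz_nat -lt0n orbit_den_gt0.
have := hom_evalE R p (orbit_num M s n) q0.
rewrite -pmulrn -orbitE; set y := map_mx ratr _; set h := hom_eval _ _ _ => hE.
have q0' : 0 < ((orbit_den M s n)%:R : R) ^+ msize p.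
  by rewrite exprn_gt0 // ltr0n orbit_den_gt0.
rewrite inE; case: sim => /=.
  by rewrite -(pmulr_rgt0 _ q0') -hE ltr0z.
by rewrite -(pmulr_rge0 _ q0') -hE ler0z.
Qed.

(** With d = [msize p] <= L, the exponent of 2 is at most 576 L d + L + 1154 L d, quadratic in L.
    Its constant is absorbed by 36^3 <= L^3, since the nine entries of [M] alone take at least 36
    bits. *)
Lemma orbit_threshold_bits (M : 'M[rat]_3) (s : 'cV[rat]_3) p L Y :
  L = instance_bits M s p -> Y = (2 ^ (2 * L))%N ->
  ((Y ^ 288) ^ msize p *
    (\sum_(z <- coef_list p) `|z| * (Y ^ (2 * 288 + 1)) ^ msize p) <= 2 ^ L ^ 5)%N.
Proof.
move=> LE ->; rewrite -big_distrl.
have L36 : (36 <= L)%N.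
  by have := mx_bits_ge M; rewrite LE /instance_bits; lia.
have dL : (msize p <= L)%N.
  by apply: leq_trans (msize_poly_bits p) _; rewrite LE /instance_bits -addnA leq_addr.
have cL : (\sum_(z <- coef_list p) `|z| <= 2 ^ L)%N.
  apply: leq_trans (ltnW (sum_absz_bits _)) _; rewrite leq_exp2l //.
  by rewrite LE /instance_bits -addnA leq_addr.
move: (msize p) dL => d dL.
apply: (@leq_trans (2 ^ (2 * L * 288 * d) * (2 ^ L * 2 ^ (2 * L * (2 * 288 + 1) * d)))%N).
  by apply: leq_mul; [|apply: leq_mul => //]; rewrite -!expnM ?mulnA.
rewrite -!expnD leq_exp2l //.
apply: (@leq_trans (36 ^ 3 * L ^ 2)); last first.
  by rewrite (expnD L 3 2) leq_mul2r leq_exp2r // L36 orbT.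
by clear -L36 dL; rewrite -(mulnn L); nia.
Qed.

(** * Eventual sign along a residue class *)

Local Open Scope complex_scope.

(** The hypothesis gives z^k = |z|^k, a real number, which conjugation fixes. *)
Lemma unity_root_conj_pow (C : numClosedFieldType) (z : C) :
  is_root_of_unity (z / `|z|) ->
  exists2 k, (0 < k)%N & z ^+ k = Num.conj z ^+ k.
Proof.
move=> [k k0 /unity_rootP zk]; exists k => //.
have zE : z ^+ k = `|z| ^+ k.
  have [->|z0] := eqVneq z 0; first by rewrite normr0.
  by apply/divr1_eq; rewrite -expr_div_n.
by rewrite -rmorphXn zE /= rmorphXn /= conj_normC.
Qed.

Lemma orbit_sign_eventually (R : realType) (M : 'M[rat]_3) (s : 'cV[rat]_3)
    (p : {mpoly int[3]}) (lam : R[i]) (rho : R) r :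
  char_poly (map_mx ratr M) =
    ('X - lam%:P) * ('X - (Num.conj lam)%:P) * ('X - (rho%:C)%:P) ->
  lam \isn't Num.real -> is_root_of_unity (lam / `|lam|) -> (r < 288)%N ->
  exists e : int, forall m, (2 ^ instance_bits M s p ^ 5 < m)%N ->
    Num.sg (hom_eval p (orbit_num M s (288 * m + r))
                       (orbit_den M s (288 * m + r))) = e.
Proof.
move=> chM lamNR lam1 r288.
have [k k0 lamk] := unity_root_conj_pow lam1.
set D : R[i] := (mx_den M)%:R.
have D0 : D != 0 by rewrite pnatr_eq0 -lt0n mx_den_gt0.
have DR : D \is Num.real by rewrite realn.
have conjD z : Num.conj (D * z) = D * Num.conj z by rewrite rmorphM /= conj_Creal.
have chA : char_poly (map_mx intr (mx_num M)) =
    ('X - (D * lam)%:P) * ('X - (Num.conj (D * lam))%:P) * ('X - (D * rho%:C)%:P).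
  by rewrite mx_numE conjD; apply: char_poly_scale3.
have DlamNR : D * lam \isn't Num.real.
  apply: contra lamNR => DlamR.
  by rewrite -(mulKf D0 lam) rpredM // rpredV.
have DrhoR : D * rho%:C \is Num.real by rewrite rpredM // complex_real.
have Dlamk : (D * lam) ^+ k = Num.conj (D * lam) ^+ k.
  by rewrite conjD !exprMn lamk.
have [a [b []]] := matrix_power_two_eigenvalues 12 chA DlamNR DrhoR k0 Dlamk.
rewrite -[(24 * 12)%N]/288%N => aA bA Aab Aeq.
(* Twice the bit length leaves room for the factor 9, the number of entries: 9 * 2^L <= 2^(4 + L) <=
   2^(2L). *)
pose L := instance_bits M s p; pose Y := (2 ^ (2 * L))%N.
have [ML sL] : (mx_bits M <= L)%N /\ (mx_bits s <= L)%N.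
  by rewrite /L /instance_bits; lia.
have L36 : (36 <= L)%N by have := mx_bits_ge M; lia.
have boundY n x : (n <= L)%N -> (x <= 9 * 2 ^ n)%N -> (x <= Y)%N.
  move=> nL /leq_trans; apply; apply: (@leq_trans (2 ^ 4 * 2 ^ L)).
    by apply: leq_mul => //; rewrite leq_exp2l.
  by rewrite -expnD leq_exp2l //; lia.
have AY : (mx_norm1 (mx_num M) <= Y)%N.
  by apply: boundY ML _; apply: mx_num_norm1_bits.
have sY : (mx_norm1 (mx_num s) <= Y)%N.
  apply: boundY sL _; apply: leq_trans (mx_num_norm1_bits _) _.
  by rewrite leq_mul2r orbT.
have DY : (mx_den M <= Y)%N.
  by apply: boundY ML _; apply: leq_trans (mx_den_bits _) _; rewrite leq_pmull.
have EY : (mx_den s <= Y)%N.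
  by apply: boundY sL _; apply: leq_trans (mx_den_bits _) _; rewrite leq_pmull.
have Y4 : (3 < Y)%N by rewrite -[4%N]/(2 ^ 2)%N leq_exp2l //; lia.
have threshold := orbit_threshold_bits (erefl L) (erefl Y).
move: (288)%N aA bA Aab Aeq r288 threshold => K aA bA Aab Aeq rK threshold.
have AYK : (mx_norm1 (mx_num M) ^ K <= Y ^ K)%N.
  by case: (K) => // K'; rewrite leq_exp2r.
have [e eE] := hom_eval_orbit_sign p Y4 AY sY rK DY EY
  (leq_trans aA AYK) (leq_trans bA AYK) Aab Aeq.
by exists e => m /(leq_ltn_trans threshold)/eE.
Qed.

(** * Computable functions *)

(* A value of type E is passed to a recursive function as a list of naturals of
   fixed length; a fixed length is what lets [RComp] rebuild the whole list. *)
Record environment (E : Type) := Environment {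
  env_args :> E -> seq nat;
  env_arity : nat;
  size_env : forall x, size (env_args x) = env_arity }.

Definition computable E (env : environment E) (f : E -> nat) : Prop :=
  exists F, forall x, computes F (env x) (f x).

Lemma size_env_cons E T (enc : T -> nat) (env : environment E) (y : T * E) :
  size (enc y.1 :: env y.2) = (env_arity env).+1.
Proof. by rewrite /= size_env. Qed.

Definition env_cons E T (enc : T -> nat) (env : environment E) :
  environment (T * E) := Environment (@size_env_cons E T enc env).

Lemma computes_comp F gs v ws y :
  size gs = size ws ->
  (forall i, (i < size gs)%N -> computes (nth RZero gs i) v (nth 0%N ws i)) ->
  computes F ws y -> computes (RComp F gs) v y.
Proof.
move=> gw gsP Fy; exists ws; split=> //.
elim: gs ws {Fy} gw gsP => [|g gs IHgs] [|w ws] //= [gw] gsP.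
split; first exact: (gsP 0%N).
by apply: IHgs => // i igs; apply: (gsP i.+1).
Qed.

Lemma choice_seq (P : nat -> recfun -> Prop) k :
  (forall i, (i < k)%N -> exists F, P i F) ->
  exists2 gs, size gs = k & forall i, (i < k)%N -> P i (nth RZero gs i).
Proof.
elim: k => [|k IHk] Pk; first by exists [::].
have [i ik|gs gsk gsP] := IHk; first by apply: Pk; rewrite ltnW.
have [F PF] := Pk k (leqnn _); exists (rcons gs F); first by rewrite size_rcons gsk.
move=> i; rewrite ltnS leq_eqVlt nth_rcons gsk => /predU1P[->|ik].
  by rewrite ltnn eqxx.
by rewrite ik; apply: gsP.
Qed.

Lemma computable_ext E (env : environment E) f g :
  f =1 g -> computable env f -> computable env g.
Proof. by move=> fg [F FP]; exists F => x; rewrite -fg. Qed.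

Lemma computable_arg E (env : environment E) i :
  computable env (fun x => nth 0%N (env x) i).
Proof. by exists (RProj i). Qed.

(** Change of variables; dropping and permuting arguments are special cases. *)
Lemma computable_subst E E' (env : environment E) (env' : environment E')
    (h : E -> E') f :
  (forall i, computable env (fun x => nth 0%N (env' (h x)) i)) ->
  computable env' f -> computable env (fun x => f (h x)).
Proof.
move=> hP [F FP].
have [|gs gsk gsP] := @choice_seq (fun i G =>
    forall x, computes G (env x) (nth 0%N (env' (h x)) i)) (env_arity env').
  by move=> i _; apply: hP.
exists (RComp F gs) => x; apply: computes_comp (FP (h x)).
  by rewrite size_env.
by move=> i; rewrite gsk => /gsP.
Qed.

Lemma computable_weaken E T (enc : T -> nat) (env : environment E) f :
  computable env f -> computable (env_cons enc env) (fun y => f y.2).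
Proof.
apply: computable_subst => i.
exact: (computable_arg (env_cons enc env) i.+1).
Qed.

Lemma computable_head E T (enc : T -> nat) (env : environment E) :
  computable (env_cons enc env) (fun y => enc y.1).
Proof. exact: (computable_arg (env_cons enc env) 0). Qed.

Lemma computable_second E T T' (enc : T -> nat) (enc' : T' -> nat)
    (env : environment E) :
  computable (env_cons enc (env_cons enc' env)) (fun y => enc' y.2.1).
Proof. exact: (computable_arg (env_cons enc (env_cons enc' env)) 1). Qed.

Lemma computable_weaken2 E T T' (enc : T -> nat) (enc' : T' -> nat)
    (env : environment E) f : computable env f ->
  computable (env_cons enc (env_cons enc' env)) (fun y => f y.2.2).
Proof.
by move=> cf; apply: (@computable_weaken _ _ _ _ (fun z => f z.2)); apply: computable_weaken.
Qed.

(** Primitive recursion on a state of any type: it runs on the codes, and the step has to be correct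
    only at codes of genuine states. *)
Lemma computable_iteri E T (env : environment E) (enc : T -> nat)
    (n : E -> nat) (f : E -> T) (g : nat -> T -> E -> T) :
  computable env n -> computable env (fun x => enc (f x)) ->
  computable (env_cons id (env_cons enc env))
    (fun y => enc (g y.1 y.2.1 y.2.2)) ->
  computable env (fun x => enc (iteri (n x) (fun i t => g i t x) (f x))).
Proof.
move=> [Fn FnP] [Ff FfP] [Fg FgP].
exists (RComp (RPrec Ff Fg) (Fn :: [seq RProj i | i <- iota 0 (env_arity env)])) => x.
apply: (@computes_comp _ _ _ (n x :: env x)).
- by rewrite /= size_map size_iota size_env.
- move=> [_ //|i] /=.
  rewrite size_map size_iota ltnS => ik.
  by rewrite (nth_map 0%N) ?size_iota // nth_iota.
- exists (fun m => enc (iteri m (fun i t => g i t x) (f x))); split=> //=.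
  by move=> i _; apply: (FgP (i, (iteri i (fun i t => g i t x) (f x), x))).
Qed.

Lemma computable_iteri_nat E (env : environment E) (n f : E -> nat)
    (g : nat -> nat -> E -> nat) :
  computable env n -> computable env f ->
  computable (env_cons id (env_cons id env)) (fun y => g y.1 y.2.1 y.2.2) ->
  computable env (fun x => iteri (n x) (fun i t => g i t x) (f x)).
Proof. exact: (@computable_iteri _ nat env id). Qed.

Lemma computable_succ E (env : environment E) f :
  computable env f -> computable env (fun x => (f x).+1).
Proof.
move=> [F FP]; exists (RComp RSucc [:: F]) => x.
by apply: (@computes_comp _ _ _ [:: f x]) => // -[|] // _ /=.
Qed.

Lemma computable_const E (env : environment E) n : computable env (fun=> n).
Proof.
by elim: n => [|n IHn]; [exists RZero | apply: computable_succ].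
Qed.

Lemma computable_add E (env : environment E) f g :
  computable env f -> computable env g -> computable env (fun x => f x + g x)%N.
Proof.
move=> cf cg.
apply: (@computable_ext _ _ (fun x => (iteri (f x) (fun _ t => t.+1) (g x)))).
  by move=> x; elim: (f x) => //= n ->.
apply: (@computable_iteri_nat _ _ f g (fun _ t _ => t.+1)) => //.
by apply: computable_succ; apply: computable_weaken; apply: computable_head.
Qed.

Lemma computable_sum E (env : environment E) n (f : nat -> E -> nat) :
  computable env n -> computable (env_cons id env) (fun y => f y.1 y.2) ->
  computable env (fun x => \sum_(i < n x) f i x)%N.
Proof.
move=> cn cf.
apply: (@computable_ext _ _ (fun x => (iteri (n x) (fun i t => t + f i x) 0)%N)).
  by move=> x; elim: (n x) => [|m] /=; rewrite ?big_ord0 // big_ord_recr => ->.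
apply: (@computable_iteri_nat _ _ n (fun=> 0%N) (fun i t x => t + f i x)%N) => //.
  exact: computable_const.
apply: computable_add; first exact: computable_second.
apply: (@computable_subst _ _ _ (env_cons id env)
  (fun y : nat * (nat * E) => (y.1, y.2.2)) (fun y => f y.1 y.2)) => // -[|i].
  exact: computable_head.
exact: (computable_arg (env_cons id (env_cons id env)) i.+2).
Qed.

Lemma computable_mul E (env : environment E) f g :
  computable env f -> computable env g -> computable env (fun x => f x * g x)%N.
Proof.
move=> cf cg.
apply: (@computable_ext _ _ (fun x => \sum_(i < f x) g x)%N).
  by move=> x; rewrite sum_nat_const card_ord.
by apply: (@computable_sum _ _ f (fun _ => g)) => //; apply: computable_weaken.
Qed.

Lemma computable_exp E (env : environment E) f g :
  computable env f -> computable env g -> computable env (fun x => f x ^ g x)%N.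
Proof.
move=> cf cg.
apply: (@computable_ext _ _ (fun x => (iteri (g x) (fun _ t => f x * t) 1)%N)).
  by move=> x; elim: (g x) => //= n ->; rewrite expnS.
apply: (@computable_iteri_nat _ _ g (fun=> 1%N) (fun _ t x => f x * t)%N) => //.
  exact: computable_const.
apply: computable_mul; first exact: computable_weaken2.
exact: computable_second.
Qed.

Lemma computable_pred E (env : environment E) f :
  computable env f -> computable env (fun x => (f x).-1).
Proof.
move=> cf; apply: (@computable_ext _ _ (fun x => (iteri (f x) (fun i _ => i) 0)%N)).
  by move=> x; case: (f x).
apply: (@computable_iteri_nat _ _ f (fun=> 0%N) (fun i _ _ => i)) => //; first exact: computable_const.
exact: computable_head.
Qed.

Lemma computable_sub E (env : environment E) f g :
  computable env f -> computable env g -> computable env (fun x => f x - g x)%N.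
Proof.
move=> cf cg.
apply: (@computable_ext _ _ (fun x => (iteri (g x) (fun _ t => t.-1) (f x)))).
  by move=> x; elim: (g x) => /= [|n ->]; rewrite ?subn0 ?subnS.
apply: (@computable_iteri_nat _ _ g f (fun _ t _ => t.-1)) => //.
by apply: computable_pred; apply: computable_weaken; apply: computable_head.
Qed.

Lemma computable_leq E (env : environment E) f g :
  computable env f -> computable env g ->
  computable env (fun x => (f x <= g x)%N : nat).
Proof.
move=> cf cg; apply: (@computable_ext _ _ (fun x => 1 - (f x - g x))%N).
  by move=> x; lia.
by apply: computable_sub; [apply: computable_const | apply: computable_sub].
Qed.

Lemma computable_and E (env : environment E) (a b : E -> bool) :
  computable env (fun x => a x : nat) -> computable env (fun x => b x : nat) ->
  computable env (fun x => (a x && b x) : nat).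
Proof.
move=> ca cb; apply: (@computable_ext _ _ (fun x => a x * b x)%N).
  by move=> x; case: (a x); case: (b x).
exact: computable_mul.
Qed.

Lemma computable_eq E (env : environment E) f g :
  computable env f -> computable env g ->
  computable env (fun x => (f x == g x) : nat).
Proof.
move=> cf cg.
apply: (@computable_ext _ _ (fun x => ((f x <= g x) && (g x <= f x))%N : nat)).
  by move=> x; rewrite eqn_leq.
by apply: computable_and; apply: computable_leq.
Qed.

Lemma computable_if E (env : environment E) (b : E -> bool) f g :
  computable env (fun x => b x : nat) -> computable env f -> computable env g ->
  computable env (fun x => if b x then f x else g x).
Proof.
move=> cb cf cg.
apply: (@computable_ext _ _ (fun x => b x * f x + (1 - b x) * g x)%N).
  by move=> x; case: (b x); rewrite ?mul1n ?mul0n ?addn0.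
apply: computable_add; apply: computable_mul => //.
by apply: computable_sub => //; apply: computable_const.
Qed.

Lemma computable_odd E (env : environment E) f :
  computable env f -> computable env (fun x => odd (f x) : nat).
Proof.
move=> cf.
apply: (@computable_ext _ _ (fun x => (iteri (f x) (fun _ t => 1 - t) 0)%N)).
  by move=> x; elim: (f x) => //= n ->; case: (odd n).
apply: (@computable_iteri_nat _ _ f (fun=> 0%N) (fun _ t _ => 1 - t)%N) => //.
  exact: computable_const.
apply: computable_sub; first exact: computable_const.
exact: computable_second.
Qed.

Lemma computable_half E (env : environment E) f :
  computable env f -> computable env (fun x => (f x)./2).
Proof.
move=> cf; apply: (@computable_ext _ _ (fun x => \sum_(i < f x) odd i)%N).
  move=> x; elim: (f x) => [|n IHn]; first by rewrite big_ord0.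
  by rewrite big_ord_recr /= IHn uphalf_half addnC.
apply: (@computable_sum _ _ f (fun i _ => odd i : nat)) => //.
by apply: computable_odd; apply: computable_head.
Qed.

(** The index list is independent of the input, so the recursive function is unrolled along it and
    indices need no code. *)
Lemma computable_big (I : Type) (idx : nat) (op : nat -> nat -> nat)
    (r : seq I) (P : pred I) E (env : environment E) (f : I -> E -> nat) :
  (forall g h, computable env g -> computable env h ->
     computable env (fun x => op (g x) (h x))) ->
  (forall i, computable env (f i)) ->
  computable env (fun x => \big[op/idx]_(i <- r | P i) f i x).
Proof.
move=> cop cf; elim: r => [|i r IHr].
  apply: (@computable_ext _ _ (fun=> idx)) (computable_const _ _) => x.
  by rewrite big_nil.
case Pi : (P i).
  by apply: (@computable_ext _ _ _ _ _ (cop _ _ (cf i) IHr)) => x; rewrite big_cons Pi.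
by apply: computable_ext IHr => x; rewrite big_cons Pi.
Qed.

(* The pairing for which [CodeSeq.code (a :: s) = pair_code a (CodeSeq.code s)]. *)
Definition pair_code (a b : nat) : nat := (2 ^ a * b.*2.+1)%N.

(** Decoding by bounded search: both components lie below their code, and exactly one pair passes
    the test, so the sum returns its component. *)
Definition code_fst (c : nat) : nat :=
  (\sum_(a < c) \sum_(b < c) a * (c == pair_code a b))%N.

Definition code_snd (c : nat) : nat :=
  (\sum_(a < c) \sum_(b < c) b * (c == pair_code a b))%N.

Lemma pair_code_inj a b a' b' :
  pair_code a b = pair_code a' b' -> a = a' /\ b = b'.
Proof.
rewrite /pair_code; elim: a a' => [|a IHa] [|a'].
- by rewrite !mul1n => /eqP; rewrite eqSS => /eqP/double_inj ->.
- by rewrite expnS -mulnA; move: (2 ^ a' * _)%N => z; lia.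
- by rewrite expnS -mulnA; move: (2 ^ a * _)%N => z; lia.
- rewrite !expnS -!mulnA => /eqP; rewrite eqn_pmul2l // => /eqP.
  by move=> /IHa[-> ->].
Qed.

Lemma pair_code_gt a b : (a < pair_code a b)%N /\ (b < pair_code a b)%N.
Proof. by have := ltn_expl a (isT : 1 < 2)%N; rewrite /pair_code; nia. Qed.

Lemma sum_pair_code (F : nat -> nat -> nat) a b :
  (\sum_(a' < pair_code a b) \sum_(b' < pair_code a b)
     F a' b' * (pair_code a b == pair_code a' b') = F a b)%N.
Proof.
have [ltac ltbc] := pair_code_gt a b.
rewrite (bigD1 (Ordinal ltac)) //= (bigD1 (Ordinal ltbc)) //= eqxx muln1.
rewrite big1 ?addn0 => [|b']; last first.
  rewrite -val_eqE /= => nb; case: eqP => [/pair_code_inj[_ bb]|]; last by rewrite muln0.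
  by case/eqP: nb.
rewrite big1 ?addn0 // => a'; rewrite -val_eqE /= => na; apply: big1 => b' _.
case: eqP => [/pair_code_inj[aa _]|]; last by rewrite muln0.
by case/eqP: na.
Qed.

Lemma code_fstK a b : code_fst (pair_code a b) = a.
Proof. exact: (sum_pair_code (fun a _ => a)). Qed.

Lemma code_sndK a b : code_snd (pair_code a b) = b.
Proof. exact: (sum_pair_code (fun _ b => b)). Qed.

Lemma computable_pair E (env : environment E) f g :
  computable env f -> computable env g ->
  computable env (fun x => pair_code (f x) (g x)).
Proof.
move=> cf cg; apply: computable_mul.
  by apply: computable_exp => //; apply: computable_const.
apply: computable_succ; apply: (@computable_ext _ _ (fun x => g x + g x)%N).
  by move=> x; rewrite addnn.
exact: computable_add.
Qed.

Lemma computable_fst E (env : environment E) f :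
  computable env f -> computable env (fun x => code_fst (f x)).
Proof.
move=> cf; apply: (@computable_sum _ _ f (fun a x =>
  \sum_(b < f x) a * (f x == pair_code a b))%N) => //.
apply: (@computable_sum _ _ (fun y => f y.2) (fun b y => y.1 * (f y.2 == pair_code y.1 b))%N).
  exact: computable_weaken.
have ca : computable (env_cons id (env_cons id env)) (fun y => y.2.1).
  exact: computable_second.
apply: computable_mul => //; apply: computable_eq; first exact: computable_weaken2.
by apply: computable_pair => //; apply: computable_head.
Qed.

Lemma computable_snd E (env : environment E) f :
  computable env f -> computable env (fun x => code_snd (f x)).
Proof.
move=> cf; apply: (@computable_sum _ _ f (fun a x =>
  \sum_(b < f x) b * (f x == pair_code a b))%N) => //.
apply: (@computable_sum _ _ (fun y => f y.2) (fun b y => b * (f y.2 == pair_code y.1 b))%N).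
  exact: computable_weaken.
have cb : computable (env_cons id (env_cons id env)) (fun y => y.1).
  exact: computable_head.
apply: computable_mul => //; apply: computable_eq; first exact: computable_weaken2.
by apply: computable_pair => //; apply: computable_weaken; apply: computable_head.
Qed.

(** * Integer arithmetic on codes *)

Definition zcomputable E (env : environment E) (f : E -> int) : Prop :=
  computable env (fun x => int_code (f x)).

Definition int_decode (n : nat) : int := if odd n then Negz n./2 else Posz n./2.

Definition int_pos (z : int) : nat := if z is Posz n then n else 0%N.

Definition int_neg (z : int) : nat := if z is Negz n then n.+1 else 0%N.

Lemma int_codeK : cancel int_code int_decode.
Proof.
by case=> n; rewrite /int_decode /= odd_double /= ?uphalf_double ?doubleK.
Qed.

Lemma int_decodeK : cancel int_decode int_code.
Proof.
by move=> n; rewrite /int_decode -{4}(odd_double_half n); case: odd.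
Qed.

Lemma int_pos_neg z : z = (int_pos z)%:Z - (int_neg z)%:Z.
Proof. by case: z => n /=; rewrite ?subr0 // NegzE sub0r. Qed.

Lemma computable_int_pos E (env : environment E) f :
  zcomputable env f -> computable env (fun x => int_pos (f x)).
Proof.
move=> cf; apply: (@computable_ext _ _ (fun x =>
  if odd (int_code (f x)) then 0 else (int_code (f x))./2)%N).
  by move=> x; case: (f x) => n /=; rewrite odd_double ?doubleK.
by apply: computable_if; [apply: computable_odd | apply: computable_const
  | apply: computable_half].
Qed.

Lemma computable_int_neg E (env : environment E) f :
  zcomputable env f -> computable env (fun x => int_neg (f x)).
Proof.
move=> cf; apply: (@computable_ext _ _ (fun x =>
  if odd (int_code (f x)) then (int_code (f x))./2.+1 else 0)%N).
  by move=> x; case: (f x) => n /=; rewrite odd_double //= uphalf_double.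
by apply: computable_if; [apply: computable_odd
  | apply: computable_succ; apply: computable_half | apply: computable_const].
Qed.

Lemma zcomputable_ext E (env : environment E) f g :
  f =1 g -> zcomputable env f -> zcomputable env g.
Proof. by move=> fg; apply: computable_ext => x; rewrite fg. Qed.

(** Sums and products of integers reduce to this case through positive and negative parts. Since
    [Negz n] is -(n+1), a negative difference is coded from the predecessor of its absolute
    value. *)
Lemma zcomputable_subn E (env : environment E) f g :
  computable env f -> computable env g ->
  zcomputable env (fun x => (f x)%:Z - (g x)%:Z).
Proof.
move=> cf cg; apply: (@computable_ext _ _ (fun x => if (g x <= f x)%N
  then (f x - g x + (f x - g x))%N else ((g x - f x).-1 + (g x - f x).-1).+1)%N).
  move=> x; case: leqP => [gf|fg]; rewrite addnn; first by rewrite subzn.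
  by have -> : (f x)%:Z - (g x)%:Z = Negz (g x - f x).-1 by lia.
have cfg : computable env (fun x => f x - g x)%N by apply: computable_sub.
have cgf : computable env (fun x => (g x - f x).-1)%N.
  by apply: computable_pred; apply: computable_sub.
apply: computable_if; first exact: computable_leq.
  exact: computable_add.
by apply: computable_succ; apply: computable_add.
Qed.

Lemma zcomputable_nat E (env : environment E) f :
  computable env f -> zcomputable env (fun x => (f x)%:Z).
Proof.
move=> cf; apply: (@zcomputable_ext _ _ (fun x => (f x)%:Z - 0%N%:Z)).
  by move=> x; rewrite subr0.
by apply: zcomputable_subn => //; apply: computable_const.
Qed.

Lemma zcomputable_add E (env : environment E) f g :
  zcomputable env f -> zcomputable env g -> zcomputable env (fun x => f x + g x).
Proof.
move=> cf cg; apply: (@zcomputable_ext _ _ (fun x =>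
  (int_pos (f x) + int_pos (g x))%N%:Z - (int_neg (f x) + int_neg (g x))%N%:Z)).
  move=> x; rewrite [f x in RHS]int_pos_neg [g x in RHS]int_pos_neg !PoszD; ring.
by apply: zcomputable_subn; apply: computable_add;
  do [exact: computable_int_pos | exact: computable_int_neg].
Qed.

Lemma zcomputable_mul E (env : environment E) f g :
  zcomputable env f -> zcomputable env g -> zcomputable env (fun x => f x * g x).
Proof.
move=> cf cg; apply: (@zcomputable_ext _ _ (fun x =>
  (int_pos (f x) * int_pos (g x) + int_neg (f x) * int_neg (g x))%N%:Z
  - (int_pos (f x) * int_neg (g x) + int_neg (f x) * int_pos (g x))%N%:Z)).
  move=> x; rewrite [f x in RHS]int_pos_neg [g x in RHS]int_pos_neg.
  by rewrite !PoszD !PoszM; ring.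
by apply: zcomputable_subn; apply: computable_add; apply: computable_mul;
  do [exact: computable_int_pos | exact: computable_int_neg].
Qed.

Lemma zcomputable_exp E (env : environment E) f g :
  zcomputable env f -> computable env g -> zcomputable env (fun x => f x ^+ g x).
Proof.
move=> cf cg; apply: (@zcomputable_ext _ _ (fun x =>
  iteri (g x) (fun _ t => f x * t) 1)).
  by move=> x; elim: (g x) => //= n ->; rewrite exprS.
apply: (@computable_iteri _ _ _ _ g (fun=> 1) (fun _ t x => f x * t)) => //.
  exact: computable_const.
apply: zcomputable_mul; first exact: (computable_weaken2 _ _ cf).
exact: computable_second.
Qed.

Lemma computable_absz E (env : environment E) f :
  zcomputable env f -> computable env (fun x => `|f x|%N).
Proof.
move=> cf; apply: (@computable_ext _ _ (fun x => int_pos (f x) + int_neg (f x))%N).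
  by move=> x; case: (f x) => n //=; rewrite addn0.
by apply: computable_add; [apply: computable_int_pos | apply: computable_int_neg].
Qed.

Lemma computable_sign_holds E (env : environment E) f sim :
  zcomputable env f -> computable env (fun x => sign_holds sim (f x) : nat).
Proof.
move=> cf; case: sim => /=.
  apply: (@computable_ext _ _ (fun x => (0 < int_pos (f x))%N : nat)).
    by move=> x; case: (f x).
  by apply: computable_leq; [apply: computable_const | apply: computable_int_pos].
apply: (@computable_ext _ _ (fun x => (int_neg (f x) <= 0)%N : nat)).
  by move=> x; case: (f x).
by apply: computable_leq; [apply: computable_int_neg | apply: computable_const].
Qed.

(** Primitive recursion carries a single number as its state, so the orbit vector is packed into
    one. *)
Definition vec_code (v : 'cV[int]_3) : nat :=
  pair_code (int_code (v ord3_0 0))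
    (pair_code (int_code (v ord3_1 0)) (int_code (v ord3_2 0))).

Lemma ord3P (P : 'I_3 -> Prop) : P ord3_0 -> P ord3_1 -> P ord3_2 -> forall i, P i.
Proof.
move=> P0 P1 P2 i; case: i => [[|[|[|i]]] lti] //.
- by rewrite (_ : Ordinal lti = ord3_0) //; apply: val_inj.
- by rewrite (_ : Ordinal lti = ord3_1) //; apply: val_inj.
- by rewrite (_ : Ordinal lti = ord3_2) //; apply: val_inj.
Qed.

Lemma computable_vec_code E (env : environment E) (v : E -> 'cV[int]_3) :
  computable env (fun x => vec_code (v x)) <->
  forall i, zcomputable env (fun x => v x i 0).
Proof.
split=> [cv|cv]; last by do 2!(apply: computable_pair; first exact: cv); apply: cv.
apply: ord3P.
- by apply: computable_ext (computable_fst cv) => x; rewrite code_fstK.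
- apply: computable_ext (computable_fst (computable_snd cv)) => x.
  by rewrite code_sndK code_fstK.
- apply: computable_ext (computable_snd (computable_snd cv)) => x.
  by rewrite !code_sndK.
Qed.

Lemma zcomputable_orbit E (env : environment E) (A : E -> 'M[int]_3)
    (v : E -> 'cV[int]_3) n :
  computable env n -> (forall i j, zcomputable env (fun x => A x i j)) ->
  (forall i, zcomputable env (fun x => v x i 0)) ->
  forall i, zcomputable env (fun x => (A x ^+ n x *m v x) i 0).
Proof.
move=> cn cA /computable_vec_code cv; apply/computable_vec_code.
apply: (@computable_ext _ _ (fun x =>
  vec_code (iteri (n x) (fun _ w => A x *m w) (v x)))).
  move=> x; congr vec_code; elim: (n x) => /= [|m ->]; first by rewrite expr0 mul1mx.
  by rewrite exprS -mulmxE mulmxA.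
apply: (@computable_iteri _ _ _ vec_code n v (fun _ w x => A x *m w)) => //.
apply/computable_vec_code => i.
have cw : forall j, zcomputable (env_cons id (env_cons vec_code env))
    (fun y => y.2.1 j 0).
  apply/computable_vec_code; exact: computable_second.
have cAi j : zcomputable (env_cons id (env_cons vec_code env)) (fun y => A y.2.2 i j).
  exact: (computable_weaken2 _ _ (cA i j)).
have cAw j := zcomputable_mul (cAi j) (cw j).
apply: zcomputable_ext
  (zcomputable_add (cAw ord3_0) (zcomputable_add (cAw ord3_1) (cAw ord3_2))) => y.
by rewrite mxE big_ord3.
Qed.

Lemma foldl_allpairs_dep (S T U V : Type) (op : V -> U -> V) (f : S -> T -> U)
    (s : seq S) (t : S -> seq T) (z : V) :
  foldl op z [seq f x y | x <- s, y <- t x] =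
  foldl (fun z x => foldl (fun z y => op z (f x y)) z (t x)) z s.
Proof.
elim: s z => //= x s IHs z; rewrite foldl_cat IHs; congr foldl.
by elim: (t x) z => //= y r IHr z; rewrite IHr.
Qed.

Lemma foldl_iota (T : Type) (op : T -> nat -> T) z n :
  foldl op z (iota 0 n) = iteri n (fun i z => op z i) z.
Proof.
by elim: n => // n IHn; rewrite -[in iota 0 _]addn1 iotaD foldl_cat IHn.
Qed.

Lemma eq_iteri (T : Type) (f g : nat -> T -> T) n z :
  (forall i z, f i z = g i z) -> iteri n f z = iteri n g z.
Proof. by move=> fg; elim: n => //= n ->. Qed.

(** The dependent ranges of the dense enumeration become three nested recursions through which one
    state is threaded. *)
Lemma foldl_triples (T : Type) (op : T -> nat * nat * nat -> T) z d :
  foldl op z (triples d) =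
  iteri d (fun i z => iteri (d - i) (fun j z =>
    iteri (d - i - j) (fun k z => op z (i, j, k)) z) z) z.
Proof.
rewrite /triples foldl_allpairs_dep foldl_allpairs_dep foldl_iota.
apply: eq_iteri => i z1; rewrite foldl_iota; apply: eq_iteri => j z2.
by rewrite foldl_iota.
Qed.

Lemma computable_foldl_triples E (env : environment E) T (enc : T -> nat) d f
    (op : T -> nat * nat * nat -> E -> T) :
  computable env d -> computable env (fun x => enc (f x)) ->
  computable (env_cons id (env_cons id (env_cons id (env_cons enc env))))
    (fun y => enc (op y.2.2.2.1 (y.2.2.1, y.2.1, y.1) y.2.2.2.2)) ->
  computable env (fun x => enc (foldl (fun t ijk => op t ijk x) (f x) (triples (d x)))).
Proof.
move=> cd cf cop; apply: (@computable_ext _ _ (fun x => enc (iteri (d x)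
  (fun i z => iteri (d x - i) (fun j z =>
    iteri (d x - i - j) (fun k z => op z (i, j, k) x) z) z) (f x)))).
  by move=> x; rewrite foldl_triples.
apply: (@computable_iteri _ _ _ enc d f (fun i z x => iteri (d x - i) (fun j z =>
    iteri (d x - i - j) (fun k z => op z (i, j, k) x) z) z)) => //.
set env1 := env_cons id (env_cons enc env).
have cd1 : computable env1 (fun y => d y.2.2 - y.1)%N.
  by apply: computable_sub; [apply: computable_weaken2 | apply: computable_head].
apply: (@computable_iteri _ _ _ enc (fun y => d y.2.2 - y.1)%N (fun y => y.2.1)
  (fun j z y => iteri (d y.2.2 - y.1 - j) (fun k z => op z (y.1, j, k) y.2.2) z)) => //.
  exact: computable_second.
set env2 := env_cons id (env_cons enc env1).
apply: (@computable_iteri _ _ env2 enc (fun y => d y.2.2.2.2 - y.2.2.1 - y.1)%N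
  (fun y => y.2.1) (fun k z y => op z (y.2.2.1, y.1, k) y.2.2.2.2)) => //.
- apply: computable_sub; last exact: computable_head.
  exact: (computable_weaken2 _ _ cd1).
- exact: computable_second.
set env3 := env_cons id (env_cons enc env2).
(* Each nested recursion prepends its index and its state. Positions 3 and 5 hold the states of the
   outer recursions; k, j, i and the current state sit at 0, 2, 4 and 1, and the outer environment
   starts at 6. *)
apply: (@computable_subst _ _ env3 _ (fun y =>
  (y.1, (y.2.2.1, (y.2.2.2.2.1, (y.2.1, y.2.2.2.2.2.2))))) _ _ cop).
by case=> [|[|[|[|i]]]] /=; [exact: (computable_arg env3 0)
  | exact: (computable_arg env3 2) | exact: (computable_arg env3 4)
  | exact: (computable_arg env3 1) | exact: (computable_arg env3 i.+4.+2)].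
Qed.

(* The state pairs the code of the coefficients still to be read with the partial
   sum, so that the dense coefficient list is consumed in its own order. *)
Definition pop_step (c : nat * nat * nat -> int) (t : nat * int)
    (x : nat * nat * nat) : nat * int :=
  (code_snd t.1, t.2 + int_decode (code_fst t.1) * c x).

Lemma foldl_pop_step (c g : nat * nat * nat -> int) l z :
  foldl (pop_step g) (CodeSeq.code [seq int_code (c x) | x <- l], z) l =
  (0%N, z + \sum_(x <- l) c x * g x).
Proof.
elim: l z => [|x l IHl] z /=; first by rewrite big_nil addr0.
rewrite /pop_step /= -[(2 ^ _ * _)%N]/(pair_code _ _) code_sndK code_fstK int_codeK.
by rewrite IHl big_cons addrA.
Qed.

Lemma zcomputable_hom_eval E (env : environment E) (p : E -> {mpoly int[3]})
    (u : E -> 'cV[int]_3) (q : E -> int) :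
  computable env (fun x => msize (p x)) ->
  computable env (fun x => CodeSeq.code [seq int_code z | z <- coef_list (p x)]) ->
  (forall i, zcomputable env (fun x => u x i 0)) -> zcomputable env q ->
  zcomputable env (fun x => hom_eval (p x) (u x) (q x)).
Proof.
move=> cd cc cu cq.
pose g (x : E) (ijk : nat * nat * nat) : int :=
  u x ord3_0 0 ^+ ijk.1.1 * u x ord3_1 0 ^+ ijk.1.2 * u x ord3_2 0 ^+ ijk.2
  * q x ^+ (msize (p x) - ijk.1.1 - ijk.1.2 - ijk.2).
pose enc (t : nat * int) := pair_code t.1 (int_code t.2).
pose c0 x := CodeSeq.code [seq int_code z | z <- coef_list (p x)].
apply: (@computable_ext _ _ (fun x => code_snd (enc (foldl
  (fun t ijk => pop_step (g x) t ijk) (c0 x, 0) (triples (msize (p x))))))).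
  move=> x; rewrite /c0 [coef_list _]/(map _ _) -map_comp.
  rewrite (foldl_pop_step (fun y => (p x)@_(mnm3 y)) (g x)).
  by rewrite /enc code_sndK add0r.
apply: computable_snd.
apply: (@computable_foldl_triples _ _ _ enc (fun x => msize (p x))
  (fun x => (c0 x, 0)) (fun t ijk x => pop_step (g x) t ijk)) => //.
  by apply: computable_pair => //; apply: computable_const.
set env' := env_cons _ _.
have weak f : computable env f -> computable env' (fun y => f y.2.2.2.2).
  by apply: computable_subst => i; apply: (computable_arg env' i.+4).
have ci : computable env' (fun y => y.2.2.1) by apply: (computable_arg env' 2).
have cj : computable env' (fun y => y.2.1) by apply: (computable_arg env' 1).
have ck : computable env' (fun y => y.1) by apply: (computable_arg env' 0).
have ct : computable env' (fun y => enc y.2.2.2.1) by apply: (computable_arg env' 3).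
have cc1 : computable env' (fun y => y.2.2.2.1.1).
  by apply: computable_ext (computable_fst ct) => y; rewrite code_fstK.
have cz : zcomputable env' (fun y => y.2.2.2.1.2).
  by apply: computable_ext (computable_snd ct) => y; rewrite code_sndK.
apply: computable_pair; first exact: computable_snd.
apply: zcomputable_add => //; apply: zcomputable_mul.
  apply: (@computable_ext _ _ (fun y => code_fst y.2.2.2.1.1)).
    by move=> y; rewrite int_decodeK.
  exact: computable_fst.
have cug i : zcomputable env' (fun y => u y.2.2.2.2 i 0) by apply: (weak _ (cu i)).
apply: zcomputable_mul; last first.
  apply: zcomputable_exp; first exact: (weak _ cq).
  by do 3!(apply: computable_sub => //); apply: (weak _ cd).
by apply: zcomputable_mul; [apply: zcomputable_mul|]; apply: zcomputable_exp.
Qed.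

(** * Reading an instance from its codes *)

Definition mx_indices m n : seq ('I_m * 'I_n) :=
  [seq (i, j) | i <- enum 'I_m, j <- enum 'I_n].

Lemma mem_mx_indices m n (ij : 'I_m * 'I_n) : ij \in mx_indices m n.
Proof. by case: ij => i j; apply: allpairs_f; rewrite mem_enum. Qed.

Lemma flatten2_nth (T : eqType) (f g : T -> nat) (l : seq T) x r :
  x \in l ->
  (nth 0 (flatten [seq [:: f y; g y] | y <- l] ++ r) (index x l).*2 = f x)%N /\
  (nth 0 (flatten [seq [:: f y; g y] | y <- l] ++ r) (index x l).*2.+1 = g x)%N.
Proof.
elim: l => //= y l IHl; rewrite inE eq_sym.
by case: eqVneq => [->|_] //= /IHl.
Qed.

Lemma size_mx_codes m n (M : 'M[rat]_(m, n)) :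
  size (mx_codes M) = (size (mx_indices m n)).*2.
Proof. by rewrite /mx_codes -/(mx_indices m n); elim: (mx_indices m n) => //= ij l ->. Qed.

Definition instance : Type := 'M[rat]_3 * 'cV[rat]_3 * {mpoly int[3]}.

Lemma size_instance_codes (x : instance) :
  size (instance_codes x.1.1 x.1.2 x.2) =
  ((size (mx_indices 3 3)).*2 + ((size (mx_indices 3 1)).*2 + 2))%N.
Proof. by rewrite /instance_codes !size_cat !size_mx_codes. Qed.

Definition instance_env : environment instance := Environment size_instance_codes.

Lemma zcomputable_mx_entry i j :
  zcomputable instance_env (fun x => numq (x.1.1 i j)) /\
  zcomputable instance_env (fun x => denq (x.1.1 i j)).
Proof.
pose k := (index (i, j) (mx_indices 3 3)).*2.
split; [have := computable_arg instance_env k | have := computable_arg instance_env k.+1];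
  apply: computable_ext => x; rewrite /= /instance_codes /mx_codes -/(mx_indices 3 3).
- by rewrite (flatten2_nth _ _ _ (mem_mx_indices (i, j))).1.
- by rewrite (flatten2_nth _ _ _ (mem_mx_indices (i, j))).2.
Qed.

Lemma zcomputable_vec_entry i j :
  zcomputable instance_env (fun x => numq (x.1.2 i j)) /\
  zcomputable instance_env (fun x => denq (x.1.2 i j)).
Proof.
pose k := (index (i, j) (mx_indices 3 1)).*2.
pose k0 := (size (mx_indices 3 3)).*2.
split; [have := computable_arg instance_env (k0 + k)
  | have := computable_arg instance_env (k0 + k.+1)];
  apply: computable_ext => x; rewrite /= /instance_codes nth_cat size_mx_codes -/k0;
  rewrite ltnNge leq_addr /= addKn /mx_codes -/(mx_indices 3 1).
- by rewrite (flatten2_nth _ _ _ (mem_mx_indices (i, j))).1.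
- by rewrite (flatten2_nth _ _ _ (mem_mx_indices (i, j))).2.
Qed.

Lemma computable_poly_codes :
  computable instance_env (fun x => msize x.2) /\
  computable instance_env
    (fun x => CodeSeq.code [seq int_code z | z <- coef_list x.2]).
Proof.
pose k := ((size (mx_indices 3 3)).*2 + (size (mx_indices 3 1)).*2)%N.
split; [have := computable_arg instance_env (k + 0)
  | have := computable_arg instance_env (k + 1)];
  apply: computable_ext => x; rewrite /= /instance_codes catA nth_cat size_cat;
  by rewrite !size_mx_codes -/k ltnNge leq_addr /= addKn.
Qed.

Lemma zcomputable_mx_num E (env : environment E) m n (M : E -> 'M[rat]_(m, n)) i j :
  (forall i j, zcomputable env (fun x => numq (M x i j))) ->
  (forall i j, zcomputable env (fun x => denq (M x i j))) ->
  zcomputable env (fun x => mx_num (M x) i j).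
Proof.
move=> cnum cden; apply: (@zcomputable_ext _ _ (fun x => numq (M x i j) *
    (\prod_(kl | kl != (i, j)) `|denq (M x kl.1 kl.2)|)%N%:Z)).
  by move=> x; rewrite mxE.
apply: zcomputable_mul => //; apply: zcomputable_nat.
apply: computable_big => [g h|kl]; first exact: computable_mul.
exact: computable_absz.
Qed.

Lemma computable_mx_den E (env : environment E) m n (M : E -> 'M[rat]_(m, n)) :
  (forall i j, zcomputable env (fun x => denq (M x i j))) ->
  computable env (fun x => mx_den (M x)).
Proof.
move=> cden; apply: computable_big => [g h|kl]; first exact: computable_mul.
exact: computable_absz.
Qed.

Lemma zcomputable_orbit_eval n :
  computable (env_cons id instance_env) n ->
  zcomputable (env_cons id instance_env) (fun y =>
    hom_eval y.2.2 (orbit_num y.2.1.1 y.2.1.2 (n y)) (orbit_den y.2.1.1 y.2.1.2 (n y))).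
Proof.
move=> cn; have [cd cc] := computable_poly_codes.
have cM i j := (zcomputable_mx_entry i j).1.
have cM' i j := (zcomputable_mx_entry i j).2.
have cs i j := (zcomputable_vec_entry i j).1.
have cs' i j := (zcomputable_vec_entry i j).2.
apply: zcomputable_hom_eval.
- exact: (computable_weaken _ cd).
- exact: (computable_weaken _ cc).
- apply: zcomputable_orbit => // [i j|i].
    exact: (computable_weaken _ (zcomputable_mx_num i j cM cM')).
  exact: (computable_weaken _ (zcomputable_mx_num i 0 cs cs')).
- apply: zcomputable_nat; apply: computable_mul.
    by apply: computable_exp => //; apply: (computable_weaken _ (computable_mx_den cM')).
  exact: (computable_weaken _ (computable_mx_den cs')).
Qed.

(** * The sampling index and the residue set *)

Definition mx_code_bound m n (M : 'M[rat]_(m, n)) : nat :=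
  (\sum_ij (int_code (numq (M ij.1 ij.2)) + int_code (denq (M ij.1 ij.2)) + 4))%N.

(** A majorant of the bit length obtained from the codes by arithmetic alone. The 4 per matrix entry
    is the 2 of [int_bits_code], once for the numerator and once for the denominator. *)
Definition code_bound (x : instance) : nat :=
  ((CodeSeq.code [seq int_code z | z <- coef_list x.2]).*2
   + mx_code_bound x.1.1 + mx_code_bound x.1.2)%N.

Lemma int_bits_code z : (int_bits z <= int_code z + 2)%N.
Proof.
rewrite /int_bits add1n addn2 !ltnS; apply: (@leq_trans `|z|); last first.
  by case: z => n /=; rewrite ?NegzE ?abszN -?addnn; lia.
case: `|z|%N => [|n]; first by rewrite trunc_log0.
by apply: ltnW; apply: leq_trans (ltn_expl _ (isT : 1 < 2)%N) (trunc_logP _ _).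
Qed.

Lemma mx_bits_code m n (M : 'M[rat]_(m, n)) : (mx_bits M <= mx_code_bound M)%N.
Proof.
rewrite mx_bitsE; apply: leq_sum => ij _.
by apply: leq_trans (leq_add (int_bits_code _) (int_bits_code _)) _; lia.
Qed.

(** The list code is exponential in its head: with head n and tail code c, 2 * 2^n (2c + 1) >= (n +
    2) + 2c, which pays for the bits of each new entry. *)
Lemma poly_bits_code p :
  (poly_bits p <= (CodeSeq.code [seq int_code z | z <- coef_list p]).*2)%N.
Proof.
rewrite /poly_bits; elim: (coef_list p) => [|z l IHl]; first by rewrite big_nil.
rewrite big_cons /=; apply: leq_trans (leq_add (int_bits_code z) IHl) _.
by have := ltn_expl (int_code z) (isT : 1 < 2)%N; nia.
Qed.

Lemma instance_bits_code (x : instance) :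
  (instance_bits x.1.1 x.1.2 x.2 <= code_bound x)%N.
Proof.
by rewrite /instance_bits !leq_add ?poly_bits_code ?mx_bits_code.
Qed.

Lemma computable_code_bound : computable instance_env code_bound.
Proof.
have cbig m n (M : instance -> 'M[rat]_(m, n)) :
    (forall i j, zcomputable instance_env (fun x => numq (M x i j))) ->
    (forall i j, zcomputable instance_env (fun x => denq (M x i j))) ->
    computable instance_env (fun x => mx_code_bound (M x)).
  move=> cnum cden; apply: computable_big => [g h|ij]; first exact: computable_add.
  apply: computable_add; last exact: computable_const.
  by apply: computable_add; [apply: cnum | apply: cden].
have [_ cc] := computable_poly_codes.
apply: computable_add; first apply: computable_add.
- by apply: computable_ext (computable_add cc cc) => x; rewrite addnn.
- by apply: cbig => i j; case: (zcomputable_mx_entry i j).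
- by apply: cbig => i j; case: (zcomputable_vec_entry i j).
Qed.

(** Beyond the sign threshold because [code_bound] dominates the bit length; one sample there
    decides the whole residue class. *)
Definition probe_index (x : instance) : nat := (2 ^ code_bound x ^ 5).+1.

Definition residue_set sim (x : instance) : {set 'I_288} :=
  [set r : 'I_288 | sign_holds sim
    (hom_eval x.2 (orbit_num x.1.1 x.1.2 (288 * probe_index x + r))
                  (orbit_den x.1.1 x.1.2 (288 * probe_index x + r)))].

Lemma computable_residue_set sim :
  computable instance_env (fun x => set_code (residue_set sim x)).
Proof.
pose h n (x : instance) :=
  hom_eval x.2 (orbit_num x.1.1 x.1.2 n) (orbit_den x.1.1 x.1.2 n).
apply: (@computable_ext _ _ (fun x => \sum_(r < 288)
    sign_holds sim (h (288 * probe_index x + r) x) * 2 ^ r)%N).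
  move=> x; rewrite /set_code [RHS]big_mkcond; apply: eq_bigr => r _.
  by rewrite inE -/(h _ x); case: sign_holds; rewrite ?mul1n ?mul0n.
apply: (@computable_sum _ _ (fun=> 288%N) (fun r x =>
    sign_holds sim (h (288 * probe_index x + r) x) * 2 ^ r)%N).
  exact: computable_const.
have cr : computable (env_cons id instance_env) (fun y => y.1) by apply: computable_head.
apply: computable_mul; last first.
  by apply: computable_exp => //; apply: computable_const.
apply: computable_sign_holds.
apply: (zcomputable_orbit_eval (n := fun y => 288 * probe_index y.2 + y.1)%N).
apply: computable_add => //; apply: computable_mul; first exact: computable_const.
apply: (computable_weaken _ (f := probe_index)); apply: computable_succ.
apply: computable_exp; first exact: computable_const.
by apply: computable_exp; [apply: computable_code_bound | apply: computable_const].
Qed.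

Theorem theorem13 (R : realType) :
  exists c : nat, forall sim : sign_cond, exists F : recfun,
  forall (M : 'M[rat]_3) (s : 'cV[rat]_3) (p : {mpoly int[3]})
         (lam : R[i]) (rho : R),
    char_poly (map_mx ratr M) =
      ('X - lam%:P) * ('X - (Num.conj lam)%:P) * ('X - (rho%:C)%:P) ->
    lam \isn't Num.real ->
    is_root_of_unity (lam / `|lam|) ->
    exists (N : nat) (X : {set 'I_288}),
      [/\ (N <= 2 ^ (instance_bits M s p ^ c))%N,
          computes F (instance_codes M s p) (set_code X)
        & forall n : nat, (N < n)%N ->
            (map_mx ratr (M ^+ n *m s) \in target R p sim)
            <-> inord (n %% 288) \in X].
Proof.
(* The bound 288 (2^(L^5) + 1) <= 2^(L^5 + 10) fits below 2^(L^6), as L >= 36. *)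
exists 6%N => sim; have [F FP] := computable_residue_set sim.
exists F => M s p lam rho chM lamNR lam1; pose x : instance := (M, s, p).
set L := instance_bits M s p.
(* Chosen so that n > N makes the quotient of n by 288 exceed the threshold 2^(L^5). *)
exists (288 * (2 ^ L ^ 5).+1)%N, (residue_set sim x); split; last 1 first.
- move=> n nN; have rn : (n %% 288 < 288)%N by rewrite ltn_mod.
  have [e eE] := orbit_sign_eventually s p chM lamNR lam1 rn.
  have mn : (2 ^ L ^ 5 < n %/ 288)%N by rewrite leq_divRL // mulnC ltnW.
  have mx : (2 ^ L ^ 5 < probe_index x)%N.
    rewrite ltnS leq_exp2l // leq_exp2r //; exact: (instance_bits_code x).
  (* Both n and the sampling point are in the same class with quotients beyond the threshold, so
     both signs equal [e]. *)
  rewrite target_orbit inE inordK // -sign_holds_sg -[in X in _ <-> X]sign_holds_sg.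
  by rewrite eE // {1 2}(divn_eq n 288) (mulnC _ 288) eE.
- have L36 : (36 <= L)%N.
    by have := mx_bits_ge M; rewrite /L /instance_bits; lia.
  apply: (@leq_trans (2 ^ 9 * 2 ^ (L ^ 5).+1)).
    apply: leq_mul => //; rewrite (expnS 2 (L ^ 5)) mul2n -addnn -addn1 leq_add2l.
    by rewrite expn_gt0.
  rewrite -expnD leq_exp2l // (expnS L 5).
  have : (1 <= L ^ 5)%N by rewrite expn_gt0; lia.
  by nia.
- exact: (FP x).
Qed.
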